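(* There exists an absolute constant $c>0$ such that the following holds. Let $p$ be a prime, let $\mathcal{H}\subseteq\mathbb{F}_p$ be a Hilbert cube, and let $$\mathcal{E}=\mathbb{F}_p\setminus(\mathcal{H}\cdot\mathcal{H})\qquad\text{and}\qquad \mathcal{F}=\mathbb{F}_p\setminus(\mathcal{H}\cdot\mathcal{H}^{-1}).$$ Then $$\#\mathcal{E}\le c\,p^{19/8}(\#\mathcal{H})^{-3/2}\qquad\text{and}\qquad \#\mathcal{F}\le c\,p^{19/8}(\#\mathcal{H})^{-3/2}.$$
   Context: $\mathbb{F}_p$ is the finite field with $p$ elements and $\#S$ denotes the cardinality of a finite set $S$. A Hilbert cube (of dimension $d$, where $d\ge 0$ is an integer) in $\mathbb{F}_p$ is a set of the form $$\left\{a_0+\sum_{i=1}^d\varepsilon_i a_i:\ \varepsilon_i\in\{0,1\}\right\}$$ for some elements $a_0,a_1,\ldots,a_d\in\mathbb{F}_p$ (not necessarily distinct or non-zero). The dimension $d$ is arbitrary, and the cardinality is that of the resulting set. For $\mathcal{A},\mathcal{B}\subseteq\mathbb{F}_p$, $\mathcal{A}\cdot\mathcal{B}=\{ab:\ a\in\mathcal{A},\ b\in\mathcal{B}\}$, and $\mathcal{H}^{-1}=\{h^{-1}:\ h\in\mathcal{H},\ h\neq 0\}$. *)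

(* Defs.v *)
From mathcomp Require Import all_boot all_order all_algebra.

Set Implicit Arguments.
Unset Strict Implicit.
Unset Printing Implicit Defensive.

Import GRing.Theory.
Local Open Scope ring_scope.

Definition hilbert_cube (F : finFieldType) (d : nat) (a0 : F) (a : 'I_d -> F) :
    {set F} :=
  [set a0 + \sum_(i < d) (eps i)%:R * a i | eps : {ffun 'I_d -> bool}].

Definition is_hilbert_cube (F : finFieldType) (H : {set F}) : Prop :=
  exists (d : nat) (a0 : F) (a : 'I_d -> F), H = hilbert_cube a0 a.

Definition prod_set (F : finFieldType) (A B : {set F}) : {set F} :=
  [set a * b | a in A, b in B].

Definition inv_set (F : finFieldType) (A : {set F}) : {set F} :=
  [set h^-1 | h in A & h != 0].

(* Main.v *)
Require Import Defs.
From mathcomp Require Import all_boot all_order all_algebra.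
From mathcomp Require Import reals exp.
From mathcomp Require Import cyclic all_field.
From mathcomp Require Import ring zify.

(** Write H = A + B with A, B subcubes and |B| about p^(1/4).  If the nonzero
    set E misses (A + B) X, then expanding the condition (a + b) x = e in the
    multiplicative characters of F_p and applying Cauchy-Schwarz and Parseval
    to the sums over X and E bounds |E| in terms of
    max |sum_{a, b} chi (a + b)| over nontrivial chi.  By Hoelder that sum is
    controlled by the complete fourth moment
    sum_x |sum_{b in B} chi (x + b)|^4, which is O(p |B|^2) as soon as
    sum_x chi ((x - c1) (x - c2) / ((x - c3) (x - c4))) is O(sqrt p).  A Moebius
    map sends c4 to infinity.

    Square-root cancellation in
    S_F = sum_x chi ((x - c1) (x - c2) / (x - c3)) is obtained as follows.  If
    K / F is a quadratic extension of finite fields, and chi is extended to K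
    through the norm, then S_F^2 + S_K = 2 W, where W is the sum of chi over
    all monic quadratics, evaluated as a Jacobi sum of modulus |F|.  Hence
    |S_K| >= |S_F|^2 - 2 |F|, so an excess of |S_F| over 3 sqrt |F| is amplified
    without bound along the tower F_p, F_(p^2), F_(p^4), ...  This contradicts
    the bound |S_K| <= C_p sqrt |K| given by Stepanov's method, whose constant
    depends on p but not on K. *)

Set Implicit Arguments.
Unset Strict Implicit.
Unset Printing Implicit Defensive.

Import Order.TTheory GRing.Theory Num.Theory.
Local Open Scope ring_scope.

(** * Quadratic extensions of finite fields *)

(** In odd characteristic 1 and -1 are distinct with the same square, so squaring is not injective,
    hence not surjective on a finite field. *)
Lemma nonsquare (F : finFieldType) : (2 : F) != 0 -> exists a : F, forall x, x ^+ 2 != a.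
Proof.
move=> nz2; have ninj : ~ injective (fun x : F => x ^+ 2).
  move=> /(_ 1 (-1)); rewrite sqrrN => /(_ erefl) /eqP.
  by rewrite -subr_eq0 opprK -[1 + 1]/(2 : F) (negPf nz2).
have /subsetPn[a _ ha] : ~~ ([set: F] \subset [set x ^+ 2 | x : F]).
  apply/negP => sub; apply: ninj.
  have : #|[set x ^+ 2 | x : F]| == #|F|.
    by rewrite eqn_leq max_card -[X in (X <= _)%N]cardsT subset_leq_card.
  by move/imset_injP => inj x y /inj; apply; rewrite inE.
exists a => x; apply: contra ha => /eqP <-; exact: imset_f.
Qed.

Lemma quad_ext (F : finFieldType) : (2 : F) != 0 ->
  exists (K : finFieldType) (iota : {rmorphism F -> K}), #|K| = (#|F| ^ 2)%N.
Proof.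
move=> /nonsquare [a ha].
have sz : size ('X^2 - a%:P : {poly F}) = 3 by rewrite size_XnsubC.
have hI : monic_irreducible_poly ('X^2 - a%:P : {poly F}).
  split; last by rewrite monicXnsubC.
  apply: cubic_irreducible; first by rewrite sz.
  by move=> x; rewrite /root !hornerE subr_eq0 ha.
exists {poly %/ _ with hI}.
have card := card_qfpoly hI; rewrite sz in card.
by exists (GRing.in_alg {poly %/ _ with hI}); rewrite card.
Qed.

(** * Multiplicative characters *)

Definition mulchar (F : finFieldType) (chi : F -> algC) :=
  [/\ chi 0 = 0, chi 1 = 1 & {morph chi : x y / x * y}].

Definition nontrivial (F : finFieldType) (chi : F -> algC) :=
  exists2 x, x != 0 & chi x != 1.

Lemma expf_card_pred (F : finFieldType) (x : F) : x != 0 -> x ^+ #|F|.-1 = 1.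
Proof.
move=> x0; apply: (mulfI x0); rewrite -exprS prednK ?expf_card ?mulr1 //.
exact: leq_trans (finNzRing_gt1 F).
Qed.

Section Mulchar.
Variables (F : finFieldType) (chi : F -> algC).
Hypothesis chiP : mulchar chi.

Let chi0 : chi 0 = 0. Proof. by case: chiP. Qed.
Let chi1 : chi 1 = 1. Proof. by case: chiP. Qed.
Let chiM : {morph chi : x y / x * y}. Proof. by case: chiP. Qed.

Lemma mulcharX x n : chi (x ^+ n) = chi x ^+ n.
Proof. by elim: n => [|n IH]; rewrite ?expr0 // !exprS chiM IH. Qed.

Lemma mulchar_norm x : x != 0 -> `|chi x| = 1.
Proof.
move=> x0; have q1 : (0 < #|F|.-1)%N by rewrite -subn1 subn_gt0 finNzRing_gt1.
apply/eqP; rewrite -(@pexpr_eq1 _ _ #|F|.-1) // -normrX -mulcharX.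
by rewrite expf_card_pred // chi1 normr1.
Qed.

Lemma mulchar_norm_le1 x : `|chi x| <= 1.
Proof. by have [->|/mulchar_norm->//] := eqVneq x 0; rewrite chi0 normr0. Qed.

(** Nonzero values have modulus 1, and the convention 0^-1 = 0 makes the identity persist at 0;
    division inside [chi] thus encodes conjugation throughout. *)
Lemma mulcharV x : chi x^-1 = (chi x)^*.
Proof.
have [->|x0] := eqVneq x 0; first by rewrite invr0 chi0 rmorph0.
have := mulchar_norm x0 => n1.
have cx0 : chi x != 0 by rewrite -normr_eq0 n1 oner_eq0.
apply: (mulfI cx0); rewrite -chiM mulfV // chi1 -normCK n1.
by rewrite expr1n.
Qed.

Lemma sum_mulchar : nontrivial chi -> \sum_x chi x = 0.
Proof.
case=> y y0 cy; apply/eqP.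
have : chi y * \sum_x chi x == \sum_x chi x.
  rewrite [X in _ == X](reindex_inj (mulfI y0)) /= mulr_sumr.
  by apply/eqP; apply: eq_bigr => x _; rewrite chiM.
by rewrite -subr_eq0 -{2}[\sum_x _]mul1r -mulrBl mulf_eq0 subr_eq0 (negPf cy).
Qed.

End Mulchar.

(** * Norm, trace and the double count of monic quadratics *)

Section QuadraticExtension.
Variables (F K : finFieldType) (iota : {rmorphism F -> K}).
Hypothesis cardK : #|K| = (#|F| ^ 2)%N.
Let q := #|F|.

(** Over F, X^q - X is the product of all X - x; evaluating its image over K at z gives a vanishing
    product. *)
Lemma frobenius_fixed (z : K) : z ^+ q = z -> exists x, z = iota x.
Proof.
move=> zq; have := congr1 (fun p => (map_poly iota p).[z]) (finField_genPoly F).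
rewrite rmorphB rmorphXn /= map_polyX !hornerE zq subrr rmorph_prod horner_prod.
move=> /esym/eqP; rewrite prodf_seq_eq0 => /hasP[x _] /=.
by rewrite rmorphB /= map_polyX map_polyC !hornerE subr_eq0 => /eqP; exists x.
Qed.

Lemma frobeniusD : {morph (fun z : K => z ^+ q) : x y / x + y}.
Proof.
move=> x y; have [p p_pr pF] := finPcharP F.
have pK : p \in [pchar K] by rewrite (fmorph_pchar iota).
apply: exprDn_pchar; rewrite (eq_pnat _ (pcharf_eq pK)) -/q.
by rewrite /q (card_pprimeChar pF) pnatX pnat_id.
Qed.

Lemma frobeniusK (z : K) : (z ^+ q) ^+ q = z.
Proof. by rewrite -exprM mulnn -cardK expf_card. Qed.

Lemma iota_frobenius x : iota x ^+ q = iota x.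
Proof. by rewrite -rmorphXn /= expf_card. Qed.

(** The product below, like the sum in [Tr], is fixed by Frobenius because |K| = q^2, so it lies in
    the image of [iota] and the default 0 is never taken. *)
Definition Nm (z : K) : F := odflt 0 [pick x | iota x == z * z ^+ q].
Definition Tr (z : K) : F := odflt 0 [pick x | iota x == z + z ^+ q].

Lemma iota_Nm z : iota (Nm z) = z * z ^+ q.
Proof.
rewrite /Nm; case: pickP => [x /eqP //|no].
have /frobenius_fixed[x hx] : (z * z ^+ q) ^+ q = z * z ^+ q.
  by rewrite exprMn frobeniusK mulrC.
by have := no x; rewrite -hx eqxx.
Qed.

Lemma iota_Tr z : iota (Tr z) = z + z ^+ q.
Proof.
rewrite /Tr; case: pickP => [x /eqP //|no].
have /frobenius_fixed[x hx] : (z + z ^+ q) ^+ q = z + z ^+ q.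
  by rewrite frobeniusD frobeniusK addrC.
by have := no x; rewrite -hx eqxx.
Qed.

Lemma NmM : {morph Nm : x y / x * y}.
Proof.
by move=> x y; apply: (fmorph_inj iota); rewrite rmorphM !iota_Nm exprMn mulrACA.
Qed.

Lemma Nm0 : Nm 0 = 0.
Proof. by apply: (fmorph_inj iota); rewrite iota_Nm mul0r rmorph0. Qed.

Lemma Nm1 : Nm 1 = 1.
Proof. by apply: (fmorph_inj iota); rewrite iota_Nm expr1n mulr1 rmorph1. Qed.

Lemma NmV z : Nm z^-1 = (Nm z)^-1.
Proof. by apply: (fmorph_inj iota); rewrite fmorphV !iota_Nm exprVn invfM. Qed.

Lemma Nm_eq0 z : (Nm z == 0) = (z == 0).
Proof. by rewrite -(fmorph_eq0 iota) iota_Nm mulf_eq0 expf_eq0 andbC; case: eqP; rewrite ?andbF. Qed.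

(** The right-hand side is the value at c of the characteristic polynomial of z over F. *)
Lemma Nm_sub_iota z c : Nm (z - iota c) = c ^+ 2 - c * Tr z + Nm z.
Proof.
apply: (fmorph_inj iota).
rewrite iota_Nm !rmorphD rmorphN rmorphXn rmorphM /= iota_Tr iota_Nm.
rewrite -[z - _]/(z + - _) frobeniusD -rmorphN iota_frobenius rmorphN; ring.
Qed.

Let Q := (F * F)%type.
Let symF (u : Q) : Q := (u.1 + u.2, u.1 * u.2).
Let symK (z : K) : Q := (Tr z, Nm z).


(* X^2 - s X + d either splits over F, giving pairs (x, y), or has two conjugate
   roots in K; a double root of F counts once on each side. *)
Lemma quadratic_roots_le2 (t : Q) :
  (#|[set u | symF u == t]| + #|[set z | symK z == t]| <= 2)%N.
Proof.
have [->|/set0Pn[[x y]]] := eqVneq [set u | symF u == t] set0.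
  rewrite cards0 add0n; have [->|/set0Pn[z]] := eqVneq [set z | symK z == t] set0.
    by rewrite cards0.
  rewrite inE => /eqP <-; apply: (@leq_trans #|[set z; z ^+ q]|); last first.
    by rewrite cards2; case: eqP.
  apply/subset_leq_card/subsetP => w; rewrite !inE => /eqP[tr nm].
  move/(congr1 iota): tr; move/(congr1 iota): nm; rewrite !iota_Nm !iota_Tr => nm tr.
  rewrite -(subr_eq0 w z) -(subr_eq0 w (z ^+ q)) -mulf_eq0.
  have -> : (w - z) * (w - z ^+ q) = w ^+ 2 - (z + z ^+ q) * w + z * z ^+ q by ring.
  by apply/eqP; rewrite -nm -tr; ring.
rewrite inE => /eqP <-.
have usub : [set u | symF u == symF (x, y)] \subset [set (x, y); (y, x)].
  apply/subsetP => -[v w]; rewrite !inE /symF /= !xpair_eqE => /andP[/eqP sm /eqP pr].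
  have /eqP : (v - x) * (v - y) = 0.
    have -> : (v - x) * (v - y) = v ^+ 2 - (x + y) * v + x * y by ring.
    by rewrite -sm -pr; ring.
  rewrite mulf_eq0 !subr_eq0 => /orP[] /eqP vE; move/eqP: sm; rewrite vE.
    by rewrite (inj_eq (addrI x)) => ->; rewrite eqxx.
  by rewrite [x + y]addrC (inj_eq (addrI y)) => ->; rewrite eqxx orbT.
have zsub z : symK z = symF (x, y) -> x = y /\ z = iota x.
  case => tr nm; move/(congr1 iota): tr; move/(congr1 iota): nm.
  rewrite !iota_Nm !iota_Tr rmorphD rmorphM => /= nm tr.
  have /eqP : (z - iota x) * (z - iota y) = 0.
    have -> : (z - iota x) * (z - iota y) =
      z ^+ 2 - (iota x + iota y) * z + iota x * iota y by ring.
    by rewrite -tr -nm; ring.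
  rewrite mulf_eq0 !subr_eq0 => /orP[] /eqP zE; move: tr;
    rewrite zE iota_frobenius.
    by move/addrI/fmorph_inj => ->.
  by move/addIr/fmorph_inj => ->.
have [xy|xy] := eqVneq x y.
  subst x.
  apply: (@leq_trans (#|[set (y, y)]| + #|[set iota y]|)); last by rewrite !cards1.
  apply: leq_add; first by rewrite setUid in usub; apply: subset_leq_card.
  apply/subset_leq_card/subsetP => z; rewrite !inE => /eqP /zsub[_ ->].
  by rewrite eqxx.
have -> : [set z | symK z == symF (x, y)] = set0.
  by apply/setP => z; rewrite !inE; apply/negP => /eqP /zsub[/eqP]; rewrite (negPf xy).
rewrite cards0 addn0.
by apply: leq_trans (subset_leq_card usub) _; rewrite cards2; case: eqP.
Qed.

(* The bound 2 is attained everywhere, since both sides sum to 2 |F|^2. *)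
Lemma quadratic_roots (t : Q) :
  (#|[set u | symF u == t]| + #|[set z | symK z == t]|)%N = 2%N.
Proof.
pose m t := (#|[set u | symF u == t]| + #|[set z | symK z == t]|)%N.
have card_fibers (T : finType) (f : T -> Q) : (\sum_t #|[set u | f u == t]|)%N = #|T|.
  rewrite -sum1_card (partition_big f xpredT) //=; apply: eq_bigr => v _.
  by rewrite sum1_card; apply: eq_card => u; rewrite !inE.
have msum : (\sum_t m t)%N = (\sum_(t : Q) 2)%N.
  rewrite big_split /= !card_fibers sum_nat_const card_prod cardK expnS expn1.
  by rewrite muln2 addnn.
have /leqif_sum : forall t, true -> (m t <= 2 ?= iff (m t == 2))%N.
  by move=> t' _; apply: leqif_eq; apply: quadratic_roots_le2.
by case=> _; rewrite msum eqxx => /esym/forall_inP/(_ t isT)/eqP.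
Qed.

(** By [quadratic_roots], the two sums together visit every monic quadratic exactly twice. *)
Lemma sum_quadratics (V : nmodType) (phi : Q -> V) :
  \sum_u phi (symF u) + \sum_z phi (symK z) = (\sum_t phi t) *+ 2.
Proof.
rewrite (partition_big symF xpredT) // [X in _ + X](partition_big symK xpredT) //=.
rewrite -big_split /= -sumrMnl; apply: eq_bigr => t _.
rewrite (eq_bigr (fun=> phi t)) => [|u /eqP-> //].
rewrite [X in _ + X](eq_bigr (fun=> phi t)) => [|u /eqP-> //].
rewrite !sumr_const -mulrnDr -(quadratic_roots t); congr (_ *+ (_ + _));
  by apply: eq_card => u; rewrite inE.
Qed.

(** As v has only q - 1 nonzero values, v + x / v misses some s. Then X^2 - s X + x has no root in
    F, and [quadratic_roots] provides one in K, of norm x. *)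
Lemma Nm_surj x : x != 0 -> exists2 z, z != 0 & Nm z = x.
Proof.
move=> x0; have [s hs] : exists s, s \notin [set v + x / v | v in [set v : F | v != 0]].
  apply/existsP; rewrite -negb_forall; apply/negP => /forallP hall.
  have := leq_imset_card (fun v => v + x / v) [set v : F | v != 0].
  apply/negP; rewrite -ltnNge.
  apply: (@leq_trans #|[set: F]|); last first.
    by apply/subset_leq_card/subsetP => s _; apply: hall.
  apply: proper_card; rewrite properE subsetT.
  by apply/subsetPn; exists 0; rewrite !inE ?eqxx.
have := quadratic_roots (s, x).
have -> : [set u | symF u == (s, x)] = set0.
  apply/setP => -[v w]; rewrite !inE /symF /= xpair_eqE.
  apply/negP => /andP[/eqP sm /eqP pr]; move/negP: hs; apply.
  have v0 : v != 0 by apply: contraNneq x0 => v0; rewrite -pr v0 mul0r.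
  by apply/imsetP; exists v; rewrite ?inE // -pr mulrC mulKf.
rewrite cards0 add0n => c2; have /set0Pn[z] : [set z | symK z == (s, x)] != set0.
  by rewrite -card_gt0 c2.
rewrite inE xpair_eqE => /andP[_ /eqP nz]; exists z => //.
by apply: contraNneq x0 => z0; rewrite -nz z0 Nm0.
Qed.
End QuadraticExtension.

(* The term x = c3 is 0, because 0^-1 = 0 and chi 0 = 0; so the division by
   x - c3 stands for multiplication by the conjugate of chi (x - c3). *)
Definition csum3 (F : finFieldType) (chi : F -> algC) (c1 c2 c3 : F) :=
  \sum_x chi ((x - c1) * (x - c2) / (x - c3)).

(** * Character sums over monic quadratics *)

Section Quadratics.
Variables (F : finFieldType) (chi : F -> algC).
Hypotheses (chiP : mulchar chi) (chiN : nontrivial chi).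

Let chi0 : chi 0 = 0. Proof. by case: chiP. Qed.
Let chi1 : chi 1 = 1. Proof. by case: chiP. Qed.
Let chiM : {morph chi : x y / x * y}. Proof. by case: chiP. Qed.

Lemma sum_mulchar_shift c : \sum_x chi (x - c) = 0.
Proof.
by rewrite -[RHS](sum_mulchar chiP chiN) [RHS](reindex_inj (addIr (- c))).
Qed.

Lemma sum_mulcharV_shift c : \sum_x chi (x - c)^-1 = 0.
Proof.
rewrite (eq_bigr (fun x => (chi (x - c))^*)) => [|x _]; last exact: mulcharV.
by rewrite -rmorph_sum sum_mulchar_shift rmorph0.
Qed.

(** Substitute x = w / u in the vanishing sum of chi (x + 1)^-1. The point u = 0 goes to x = 0,
    whose term 1 has no counterpart here. *)
Lemma sum_mulchar_ratio w : w != 0 -> \sum_u chi (u / (u + w)) = -1.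
Proof.
move=> w0; have hinj : injective (fun u : F => w / u).
  by move=> u v /(mulfI w0)/invr_inj.
have := sum_mulcharV_shift (-1).
rewrite (reindex_inj hinj) (bigD1 0) //= invr0 mulr0 add0r opprK invr1 chi1.
move/eqP; rewrite addrC addr_eq0 => /eqP <-.
rewrite (bigD1 0) //= mul0r chi0 add0r; apply: eq_bigr => u u0.
congr chi; rewrite -{1}(divff u0) -mulrDl invf_div [w + _]addrC //.
Qed.

(** For fixed u the sum over v is -1 by [sum_mulchar_ratio], except at u = -1, where it is |F| - 1;
    what remains is the sum of chi over u. *)
Lemma sum_mulchar_conic :
  \sum_(t : F * F) chi (t.1 * t.2 / (1 + t.1 + t.2)) = #|F|%:R * chi (-1).
Proof.
transitivity (\sum_u \sum_v chi u * chi (v / (v + (1 + u)))).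
  rewrite pair_big; apply: eq_bigr => -[u v] _ /=.
  by rewrite -chiM mulrA [v + _]addrC.
rewrite (bigD1 (-1)) //= subrr -mulr_sumr (bigD1 0) //= mul0r chi0 add0r.
rewrite (eq_bigr (fun=> 1)) => [|u u0]; last by rewrite addr0 divff.
rewrite [X in _ + X](eq_bigr (fun u => - chi u)) => [|u u1]; last first.
  rewrite -mulr_sumr sum_mulchar_ratio ?mulrN1 //.
  by rewrite addrC addr_eq0.
have /eqP := sum_mulchar chiP chiN; rewrite (bigD1 (-1)) //= addrC addr_eq0 => /eqP e.
rewrite sumrN e opprK sumr_const mulr_natr -mulrSr mulr_natl; congr (_ *+ _).
rewrite (cardD1 0 F) inE add1n; congr _.+1; apply: eq_card => u.
by rewrite !inE andbT.
Qed.

Lemma norm_sum_quadratics c1 c2 c3 : c1 != c2 -> c1 != c3 -> c2 != c3 ->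
  `| \sum_(t : F * F) chi ((c1 ^+ 2 - c1 * t.1 + t.2) * (c2 ^+ 2 - c2 * t.1 + t.2) /
        (c3 ^+ 2 - c3 * t.1 + t.2)) | = #|F|%:R.
Proof.
move=> c12 c13 c23.
have n12 : c1 - c2 != 0 by rewrite subr_eq0.
have n13 : c1 - c3 != 0 by rewrite subr_eq0.
have n23 : c2 - c3 != 0 by rewrite subr_eq0.
(* For P = X^2 - s X + d with (s, d) = h (u, v), P(c1) and P(c2) are constant multiples of u and v,
   and P(c3) = (c1 - c3) (c2 - c3) (1 + u + v). *)
pose h (t : F * F) := (c1 + c2 + (c1 - c3) * t.1 + (c2 - c3) * t.2,
  c1 * c2 + c2 * ((c1 - c3) * t.1) + c1 * ((c2 - c3) * t.2)).
have hinj : injective h.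
  move=> [u v] [u' v'] [] /= e1 e2.
  move/eqP: e1; move/eqP: e2; rewrite -subr_eq0 => /eqP e2; rewrite -subr_eq0 => /eqP e1.
  have : ((c1 - c2) * (c1 - c3)) * (u - u') = 0.
    by rewrite -(subrr 0) -{1}(mulr0 c1) -{1}e1 -e2; ring.
  have : ((c1 - c2) * (c2 - c3)) * (v - v') = 0.
    by rewrite -(subrr 0) -{2}(mulr0 c2) -{2}e1 -{1}e2; ring.
  move=> /eqP + /eqP.
  rewrite !mulf_eq0 (negPf n12) (negPf n13) (negPf n23) /= !subr_eq0.
  by move=> /eqP-> /eqP->.
rewrite (reindex_inj hinj) /=.
rewrite (eq_bigr (fun t => chi (- (c1 - c2) ^+ 2) *
  chi (t.1 * t.2 / (1 + t.1 + t.2)))) => [|[u v] _ /=].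
  rewrite -mulr_sumr sum_mulchar_conic !normrM !(mulchar_norm chiP).
  - by rewrite mul1r mulr1 normr_nat.
  - by rewrite oppr_eq0 oner_eq0.
  - by rewrite oppr_eq0 expf_neq0.
rewrite -chiM; congr chi.
set P3 := (X in _ / X = _).
have -> : P3 = ((c1 - c3) * (c2 - c3)) * (1 + u + v).
  by rewrite /P3; ring.
set P12 := (X in X / _ = _).
have -> : P12 = ((c1 - c3) * (c2 - c3)) * (- (c1 - c2) ^+ 2 * (u * v)).
  by rewrite /P12; ring.
by rewrite -mulf_div divff ?mulf_neq0 // mul1r !mulrA.
Qed.

End Quadratics.

Section Doubling.
Variables (F K : finFieldType) (iota : {rmorphism F -> K}).
Hypothesis cardK : #|K| = (#|F| ^ 2)%N.
Variable chi : F -> algC.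
Hypotheses (chiP : mulchar chi) (chiN : nontrivial chi).
Let chiM : {morph chi : x y / x * y}. Proof. by case: chiP. Qed.

Lemma mulchar_Nm : mulchar (chi \o Nm iota).
Proof.
case: chiP => chi0 chi1 _; split => [||x y] /=; rewrite ?Nm0 ?Nm1 //.
by rewrite NmM.
Qed.

Lemma nontrivial_Nm : nontrivial (chi \o Nm iota).
Proof. by case: chiN => x /(Nm_surj iota cardK)[z z0 <-] hx; exists z. Qed.

(* Both (x, y) in F * F and z in K are mapped to the coefficients of a monic
   quadratic P, and the summand depends only on the values P(c_i). *)
Lemma csum3_doubling c1 c2 c3 : c1 != c2 -> c1 != c3 -> c2 != c3 ->
  `|csum3 chi c1 c2 c3| ^+ 2 <=
  `|csum3 (chi \o Nm iota) (iota c1) (iota c2) (iota c3)| + (2 * #|F|)%:R.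
Proof.
move=> c12 c13 c23.
pose phi (t : F * F) := chi ((c1 ^+ 2 - c1 * t.1 + t.2) *
   (c2 ^+ 2 - c2 * t.1 + t.2) / (c3 ^+ 2 - c3 * t.1 + t.2)).
have e1 : csum3 chi c1 c2 c3 ^+ 2 = \sum_(u : F * F) phi (u.1 + u.2, u.1 * u.2).
  rewrite expr2 /csum3 big_distrlr pair_big /=; apply: eq_bigr => -[x y] _ /=.
  rewrite -chiM mulrACA -invfM mulrACA /phi /=; congr chi.
  by congr (_ * _ / _); ring.
have e2 : csum3 (chi \o Nm iota) (iota c1) (iota c2) (iota c3) =
    \sum_z phi (Tr iota z, Nm iota z).
  apply: eq_bigr => z _ /=.
  by rewrite !(NmM iota cardK) (NmV iota cardK) !(Nm_sub_iota iota cardK).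
have e := sum_quadratics iota cardK phi; rewrite -e1 -e2 in e.
rewrite -normrX.
have -> : csum3 chi c1 c2 c3 ^+ 2 = (\sum_t phi t) *+ 2 -
  csum3 (chi \o Nm iota) (iota c1) (iota c2) (iota c3) by rewrite -e addrK.
rewrite natrM [X in _ <= X]addrC; apply: le_trans (ler_normB _ _) _; rewrite lerD2r.
rewrite -(norm_sum_quadratics chiP chiN c12 c13 c23) normrMn mulr_natl.
exact: lexx.
Qed.
End Doubling.

(** * Stepanov's method *)

(** Pigeonhole: two distinct vectors have the same image, and their difference is a nontrivial
    solution. *)
Lemma homogeneous_system (F : finFieldType) (S T : finType) (a : S -> T -> F) :
  (#|S| < #|T|)%N ->
  exists2 k : {ffun T -> F}, k != 0 & forall s, \sum_t k t * a s t = 0.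
Proof.
move=> ST; pose L (k : {ffun T -> F}) := [ffun s => \sum_t k t * a s t].
have /injectivePn[k1 [k2 k12 eL]] : ~~ injectiveb L.
  apply/negP => /injectiveP /leq_card; rewrite !card_ffun leqNgt => /negP; apply.
  by rewrite ltn_exp2l // finNzRing_gt1.
exists (k1 - k2); first by rewrite subr_eq0.
move=> s; move/ffunP/(_ s): eL; rewrite !ffunE => eL.
rewrite (eq_bigr (fun t => k1 t * a s t - k2 t * a s t)) => [|t _].
  by rewrite sumrB eL subrr.
by rewrite !ffunE mulrBl.
Qed.

(** Among the terms with nonzero coefficient, the one of largest size cannot be cancelled. *)
Lemma sum_distinct_sizes (F : fieldType) (T : finType) (b : T -> {poly F}) (k : T -> F) :
  (forall t, b t != 0) -> injective (fun t => size (b t)) ->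
  \sum_t k t *: b t = 0 -> forall t, k t = 0.
Proof.
move=> b0 binj s0 t; apply/eqP; apply: contraT => kt.
have [m km mmax] := @arg_maxnP _ t (fun t => k t != 0) (fun t => size (b t)) kt.
have szm : (0 < size (b m))%N by rewrite size_poly_gt0.
have szl : (size (\sum_(i | i != m) k i *: b i)%R < size (b m))%N.
  rewrite -(prednK szm) ltnS; apply: leq_trans (size_sum _ _ _) _.
  apply/bigmax_leqP => i im; rewrite -ltnS (prednK szm).
  have [->|ki] := eqVneq (k i) 0; first by rewrite scale0r size_poly0.
  rewrite size_scale // ltn_neqAle (mmax i ki : (size (b i) <= size (b m))%N) andbT.
  by apply: contra im => /eqP /binj ->.
move/eqP: s0; rewrite (bigD1 m) //= addr_eq0 => /eqP e.
by move: szl; rewrite -size_polyN -e size_scale // ltnn.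
Qed.

Lemma dvdp_prod_XsubC_exp (F : fieldType) (P : {poly F}) (M : nat) (s : seq F) :
  uniq s -> (forall x, x \in s -> ('X - x%:P) ^+ M %| P) ->
  \prod_(x <- s) ('X - x%:P) ^+ M %| P.
Proof.
elim: s => [|x s IH] /=; first by rewrite big_nil dvd1p.
case/andP => xs us h; rewrite big_cons Gauss_dvdp.
  rewrite h ?mem_head // IH // => y ys; apply: h; by rewrite inE ys orbT.
rewrite coprimep_expl //.
elim: s xs {IH us h} => [|y s IH]; first by rewrite big_nil coprimep1.
rewrite inE negb_or big_cons coprimepMr => /andP[xy /IH ->]; rewrite andbT.
by rewrite coprimep_expr // coprimep_XsubC root_XsubC eq_sym.
Qed.

(* An element of {poly {poly F}} is read as a polynomial in T over F[X]; xdeg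
   bounds its degree in X. *)
Definition xdeg (F : fieldType) (m : nat) (P : {poly {poly F}}) :=
  forall l, (size (P`_l)%R <= m.+1)%N.

Section Xdeg.
Variable F : fieldType.
Implicit Types (P Q : {poly {poly F}}).

Lemma xdeg_sum (I : Type) (r : seq I) m (P : I -> {poly {poly F}}) (p : pred I) :
  (forall i, p i -> xdeg m (P i)) -> xdeg m (\sum_(i <- r | p i) P i).
Proof.
move=> h l; rewrite coef_sum; apply: (big_ind (fun x : {poly F} => (size x <= m.+1)%N)).
- by rewrite size_poly0.
- by move=> x y hx hy; apply: leq_trans (size_polyD _ _) _; rewrite geq_max hx.
- by move=> i pi; apply: h.
Qed.

Lemma xdegM m1 m2 P Q : xdeg m1 P -> xdeg m2 Q -> xdeg (m1 + m2) (P * Q).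
Proof.
move=> h1 h2 l; rewrite coefM; apply: (big_ind (fun x : {poly F} => (size x <= (m1 + m2).+1)%N)).
- by rewrite size_poly0.
- by move=> x y hx hy; apply: leq_trans (size_polyD _ _) _; rewrite geq_max hx.
- move=> i _; apply: leq_trans (size_polyMleq _ _) _.
  by have := h1 i; have := h2 (l - i)%N; lia.
Qed.

Lemma xdegC m (p : {poly F}) : (size p <= m.+1)%N -> xdeg m p%:P.
Proof. by move=> h l; rewrite coefC; case: ifP => // _; rewrite size_poly0. Qed.

Lemma xdegX m P : xdeg m P -> forall r, xdeg (m * r) (P ^+ r).
Proof.
move=> h; elim=> [|r IH]; first by apply: xdegC; rewrite size_poly1.
by rewrite exprS mulnS; apply: xdegM.
Qed.

Lemma xdegXn r : xdeg 0 ('X^r : {poly {poly F}}).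
Proof. by move=> l; rewrite coefXn; case: eqP => _; rewrite ?size_poly1 ?size_poly0. Qed.

Lemma xdegW m1 m2 P : (m1 <= m2)%N -> xdeg m1 P -> xdeg m2 P.
Proof. by move=> h hP l; apply: leq_trans (hP l) _. Qed.
End Xdeg.

Section Stepanov.
Variables (F : finFieldType) (n e : nat) (f : {poly F}) (w : F).
Hypothesis cardF : (n * e).+1 = #|F|.
Hypothesis size_f : size f = n.+2.
Variables (M J D : nat).
Hypotheses (ltDe : (D < e)%N) (leMq : (M <= #|F|)%N).
Local Notation q := #|F|.
Local Notation T := ('I_n * 'I_J * 'I_D)%type.

Let f0 : f != 0. Proof. by rewrite -size_poly_gt0 size_f. Qed.

(* A combination of these monomials with field coefficients is forced to vanish
   to order M at every x with f(x)^e = w.  It is nonzero because the degrees are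
   distinct: (n + 1) e i = (q - 1) i + e i with q = n e + 1, so they are separated
   modulo q by e i - i and the exponent below D. *)
Definition stepanov_monomial (t : T) : {poly F} :=
  'X^(t.2 + q * t.1.2) * f ^+ (M + e * t.1.1).

(** This is (f(X + T) - f(X)) / T, with divided derivatives so that it makes sense in positive
    characteristic. *)
Definition taylor_quotient : {poly {poly F}} := \poly_(l < n.+1) f^`N(l.+1).

(* The expansion of the monomial at X + T modulo T^M, simplified by X^q = X and
   f(X)^e = w; 'X is T and 'X%:P is X.  Its coefficients have degree about
   D + (n + 1) M, much smaller than the degree of the monomial. *)
Definition stepanov_local (t : T) : {poly {poly F}} :=
  (w ^+ t.1.1 *: 'X^(t.1.2))%:P * ('X + 'X%:P) ^+ t.2 *
  \sum_(r < M) (f ^+ (M - r) *+ 'C(M + e * t.1.1, r))%:P * 'X^r * taylor_quotient ^+ r.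

Lemma size_stepanov_monomial t :
  size (stepanov_monomial t) = (t.2 + q * t.1.2 + n.+1 * (M + e * t.1.1)).+1.
Proof.
rewrite /stepanov_monomial mulrC size_mulXn ?expf_neq0 //.
rewrite -addnS; congr (_ + _)%N; rewrite -[n.+1]/(n.+2.-1) -size_f -size_exp prednK //.
by rewrite size_poly_gt0 expf_neq0.
Qed.

Lemma stepanov_monomial_inj : injective (fun t => size (stepanov_monomial t)).
Proof.
move=> [[i j] d] [[i' j'] d']; rewrite !size_stepanov_monomial /= => -[h].
have D0 : (0 < D)%N by apply: leq_ltn_trans (ltn_ord d).
have e0 : (0 < e)%N by lia.
(* From n e = q - 1, (n + 1) e a = (e - 1) a + q a. *)
have red (a b c : nat) : (a < n)%N -> (c < D)%N ->
    (c + q * b + n.+1 * (M + e * a) = (c + e.-1 * a) + (a + b) * q + n.+1 * M)%N.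
  move=> _ _; rewrite -cardF; case: (e) e0 => // e' _ /=; lia.
have small (a c : nat) : (a < n)%N -> (c < D)%N -> (c + e.-1 * a < q)%N.
  by rewrite -cardF => an cD; nia.
rewrite !red // in h; move/addIn : h => h.
have h1 : (d + e.-1 * i = d' + e.-1 * i')%N.
  have := congr1 (modn^~ q) h; rewrite /= ![(_ + _ * q)%N]addnC !modnMDl.
  by rewrite !modn_small ?small.
have h2 : (i + j = i' + j')%N.
  by apply/eqP; move/eqP: h; rewrite h1 eqn_add2l eqn_pmul2r // -cardF.
(* As d and d' are below D <= e - 1, division by e - 1 recovers i. *)
have ii : (i = i' :> nat).
  have := congr1 (divn^~ e.-1) h1; rewrite /= ![(_ + e.-1 * _)%N]addnC ![(e.-1 * _)%N]mulnC.
  rewrite !divnMDl; [|lia|lia]; rewrite !divn_small ?addn0 //.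
    by apply: leq_trans (ltn_ord d') _; lia.
  by apply: leq_trans (ltn_ord d) _; lia.
congr (_, _, _); apply: ord_inj => //.
  by move: h2; rewrite ii; apply: addnI.
by move: h1; rewrite ii; apply: addIn.
Qed.

Lemma xdeg_stepanov_local t : xdeg (J + D + n.+1 * M).-1 (stepanov_local t).
Proof.
case: t => [[i j] d]; rewrite /stepanov_local /=.
apply: (@xdegW _ (j + d + n.+1 * M)).
  by have := ltn_ord j; have := ltn_ord d; lia.
apply: xdegM; first apply: xdegM.
- apply: xdegC; apply: leq_trans (size_scale_leq _ _) _; by rewrite size_polyXn.
- rewrite -[X in xdeg X](mul1n (d : nat)); apply: xdegX.
  move=> l; rewrite coefD coefC coefX.
  apply: leq_trans (size_polyD _ _) _; rewrite geq_max.
  by case: eqP => _; case: eqP => _; rewrite ?size_poly1 ?size_polyX ?size_poly0.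
apply: xdeg_sum => r _.
(* The r factors f missing from f^M are made up for by r factors [taylor_quotient], so the bound on
   the degree in X does not depend on r. *)
have := ltn_ord r => rM; rewrite (_ : (n.+1 * M = n.+1 * (M - r) + 0 + n.+1 * r)%N); last first.
  by rewrite addn0 -mulnDr subnK // ltnW.
apply: xdegM; first apply: xdegM.
- apply: xdegC; rewrite -scaler_nat; apply: leq_trans (size_scale_leq _ _) _.
  by apply: leq_trans (size_poly_exp_leq _ _) _; rewrite size_f.
- exact: xdegXn.
apply: xdegX => l; rewrite coef_poly; case: ifP => _; last by rewrite size_poly0.
by rewrite /nderivn; apply: leq_trans (size_poly _ _) _; rewrite size_f; lia.
Qed.

Definition evalX (x : F) : {poly {poly F}} -> {poly F} := map_poly (horner_eval x).

Lemma taylor_shift x :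
  f \Po ('X + x%:P) = (f.[x])%:P + 'X * evalX x taylor_quotient.
Proof.
have cxX : GRing.comm (x%:P) 'X := mulrC _ _.
rewrite /comp_poly ['X + _]addrC (nderiv_taylor_wide cxX (n := n.+2)); last first.
  by rewrite (size_map_inj_poly (@polyC_inj _)) ?size_f.
rewrite big_ord_recl expr0 mulr1 nderivn0 horner_map /=; congr (_ + _).
rewrite /evalX /taylor_quotient poly_def rmorph_sum mulr_sumr; apply: eq_bigr => l _ /=.
by rewrite map_polyZ /= map_polyXn nderivn_map horner_map /= exprS mulrCA -mul_polyC.
Qed.

(** Since x^q = x, (X + x)^q = X^q + x, which is x modulo X^q. *)
Lemma frobenius_shift x j :
  ('X^q : {poly F}) %| ('X + x%:P) ^+ (q * j) - (x ^+ j)%:P.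
Proof.
rewrite exprM; have [p p_pr pF] := finPcharP F.
have pX : p \in [pchar {poly F}] by rewrite pchar_poly.
have -> : ('X + x%:P) ^+ q = 'X^q + x%:P.
  rewrite exprDn_pchar; last first.
    by rewrite (eq_pnat _ (pcharf_eq pX)) (card_pprimeChar pF) pnatX pnat_id.
  by rewrite -polyC_exp expf_card.
by rewrite polyC_exp subrXX addrK dvdp_mulr.
Qed.

(** Modulo X^M, the factor of exponent q j collapses to x^j as M <= q, and in the binomial expansion
    of f(x + X)^(M + e i) only r < M survives, where f(x)^(M - r + e i) = w^i f(x)^(M - r). *)
Lemma stepanov_congruence t x : f.[x] ^+ e = w ->
  ('X^M : {poly F}) %| stepanov_monomial t \Po ('X + x%:P) - evalX x (stepanov_local t).
Proof.
case: t => [[i j] d] yw; set y := f.[x] in yw *.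
pose h := evalX x taylor_quotient; pose N := (M + e * i)%N.
pose S := \sum_(r < M) (y ^+ (M - r) *+ 'C(N, r))%:P * 'X^r * h ^+ r.
have -> : evalX x (stepanov_local (i, j, d)) =
    (w ^+ i * x ^+ j)%:P * ('X + x%:P) ^+ d * S.
  rewrite /evalX /stepanov_local !rmorphM rmorph_sum rmorphXn rmorphD /=.
  rewrite map_polyX !map_polyC /= !horner_evalE !hornerE polyCM.
  congr (_ * _); apply: eq_bigr => r _ /=.
  rewrite !rmorphM !rmorphXn /= map_polyX map_polyC /= horner_evalE.
  by rewrite hornerMn horner_exp.
rewrite /stepanov_monomial comp_polyM !rmorphXn /= comp_polyX taylor_shift -/y -/h -/N.
rewrite exprD.
set A := ('X + x%:P) ^+ (q * j); set B := (y%:P + 'X * h) ^+ N.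
have dA : ('X^M : {poly F}) %| A - (x ^+ j)%:P.
  by apply: dvdp_trans (frobenius_shift x j); rewrite dvdp_exp2l.
have dB : ('X^M : {poly F}) %| B - (w ^+ i)%:P * S.
  rewrite /B exprDn -(big_mkord xpredT (fun r => y%:P ^+ (N - r) * ('X * h) ^+ r *+ 'C(N, r))).
  rewrite (@big_cat_nat _ _ _ M) //=; last by rewrite /N -addnS leq_addr.
  rewrite big_mkord addrAC (_ : \sum_(r < M) _ = (w ^+ i)%:P * S); last first.
    rewrite mulr_sumr; apply: eq_bigr => r _.
    have -> : (N - r = M - r + e * i)%N by rewrite /N; have := ltn_ord r; lia.
    rewrite exprD -yw polyCMn !polyC_exp -exprM exprMn !mulrnAl mulrnAr.
    by congr (_ *+ _); rewrite -!mulrA mulrCA.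
  rewrite subrr add0r big_nat; apply: (big_ind (fun p : {poly F} => 'X^M %| p)) => [|p1 p2|r].
  - exact: dvdp0.
  - exact: dvdp_add.
  case/andP=> Mr _; rewrite -mulr_natr dvdp_mulr // dvdp_mull // exprMn dvdp_mulr //.
  exact: dvdp_exp2l.
rewrite (_ : _ - _ = ('X + x%:P) ^+ d * ((A - (x ^+ j)%:P) * B +
   (x ^+ j)%:P * (B - (w ^+ i)%:P * S))); last by rewrite ?polyCM; ring.
by apply/dvdp_mull/dvdp_add; [apply: dvdp_mulr | apply: dvdp_mull].
Qed.

(** The size condition says that there are fewer linear equations (M powers of T, each with J + D +
    (n + 1) M coefficients in X) than monomials. A nonzero combination then vanishes to order M on
    the solution set, and its degree bounds M times the number of solutions. *)
Lemma stepanov_bound : w != 0 -> (0 < M)%N ->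
  (M * (J + D + n.+1 * M) < n * J * D)%N ->
  (#|[set x | f.[x] ^+ e == w]| * M <= D + q * J.-1 + n.+1 * (M + e * n.-1))%N.
Proof.
move=> w0 M0 cnt; set Z := [set x | _].
have [|k k0 hk] := @homogeneous_system F ('I_M * 'I_(J + D + n.+1 * M))%type T
  (fun s t => (stepanov_local t)`_s.1`_s.2).
  by rewrite !card_prod !card_ord.
pose Psi := \sum_t k t *: stepanov_monomial t.
have Psi0 : Psi != 0.
  apply: contra k0 => /eqP e0; apply/eqP/ffunP => t; rewrite ffunE.
  apply: (sum_distinct_sizes _ stepanov_monomial_inj e0) => t'.
  by rewrite mulf_neq0 ?expf_neq0 ?polyX_eq0.
have dvdPsi x : x \in Z -> ('X - x%:P) ^+ M %| Psi.
  rewrite inE => /eqP fx.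
  have -> : Psi = (Psi \Po ('X + x%:P)) \Po ('X - x%:P).
    by rewrite -comp_polyA comp_polyD comp_polyX comp_polyC subrK comp_polyXr.
  rewrite -(comp_Xn_poly ('X - x%:P)) //; apply: dvdp_comp_poly.
  have : ('X^M : {poly F}) %| \sum_t k t *: evalX x (stepanov_local t).
    apply/dvdpP; exists (drop_poly M (\sum_t k t *: evalX x (stepanov_local t))).
    rewrite -[LHS](poly_take_drop M) (_ : take_poly M _ = 0) ?add0r //.
    (* For l < M the coefficient of T^l vanishes as a polynomial in X by the choice of [k], hence
       simultaneously at all points x. *)
    apply/polyP => l; rewrite coef_take_poly coef0; case: ifP => // lM.
    transitivity (horner_eval x (\sum_t k t *: (stepanov_local t)`_l)).
      rewrite rmorph_sum coef_sum; apply: eq_bigr => t _.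
      by rewrite coefZ coef_map /= !horner_evalE hornerZ.
    rewrite (_ : \sum_t _ = 0) ?rmorph0 //; apply/polyP => r; rewrite coef_sum coef0.
    have [rE|rE] := ltnP r (J + D + n.+1 * M).
      rewrite -[RHS](hk (Ordinal lM, Ordinal rE)) /=.
      by apply: eq_bigr => t _; rewrite coefZ.
    apply: big1 => t _; rewrite coefZ nth_default ?mulr0 //.
    by apply: leq_trans (xdeg_stepanov_local t l) _; move: rE M0; lia.
  have -> : Psi \Po ('X + x%:P) =
      \sum_t k t *: (stepanov_monomial t \Po ('X + x%:P) - evalX x (stepanov_local t)) +
      \sum_t k t *: evalX x (stepanov_local t).
    rewrite raddf_sum -big_split; apply: eq_bigr => t _ /=.
    by rewrite -scalerDr subrK comp_polyZ.
  move=> dv; apply: dvdp_add; last exact: dv.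
  apply: (big_ind (fun p : {poly F} => 'X^M %| p)) => [|p1 p2|t _]; first exact: dvdp0.
    exact: dvdp_add.
  by rewrite -mul_polyC; apply/dvdp_mull/stepanov_congruence.
have := dvdp_prod_XsubC_exp (enum_uniq Z) => /(_ Psi M) dv.
have {dv} /(dvdp_leq Psi0) : \prod_(x <- enum Z) ('X - x%:P) ^+ M %| Psi.
  by apply: dv => x; rewrite mem_enum; apply: dvdPsi.
rewrite size_prod_seq; last by move=> x _; rewrite expf_neq0 // polyXsubC_eq0.
rewrite (eq_bigr (fun=> M.+1)) => [|x _]; last by rewrite size_exp_XsubC.
rewrite big_const_seq count_predT -cardE iter_addn_0.
move=> sz; have : (size Psi <= (D + q * J.-1 + n.+1 * (M + e * n.-1)).+1)%N.
  apply: leq_trans (size_sum _ _ _) _; apply/bigmax_leqP => -[[i j] d] _.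
  apply: leq_trans (size_scale_leq _ _) _; rewrite size_stepanov_monomial ltnS /=.
  have := ltn_ord i; have := ltn_ord j; have := ltn_ord d => hd hj hi.
  apply: leq_add; first apply: leq_add; first exact: ltnW.
    by rewrite leq_mul2l; apply/orP; right; lia.
  rewrite leq_mul2l /= leq_add2l leq_mul2l; apply/orP; right; lia.
by move: sz; rewrite mulSn; set c := #|Z|; set s := size _; lia.
Qed.

End Stepanov.

(** * Point counts and a crude square-root bound over large fields *)

Section CrudeBound.
Variables (F : finFieldType) (n e c J : nat).
Hypotheses (cardF : (n * e).+1 = #|F|) (cardF2 : #|F| = ((c * J) ^ 2)%N).
Hypotheses (le2n : (2 <= n)%N) (le4J : (4 <= J)%N) (len2c : (n ^ 2 <= c)%N).
(** As |F| = (c J)^2, this error term is c (n^2 + n + 4) sqrt |F|. *)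
Let B := (c ^ 2 * (n ^ 2 + n + 4) * J)%N.

(* Stepanov's bound with M = n J - 4 and D = e - 1. *)
Lemma stepanov_count (f : {poly F}) w : size f = n.+2 -> w != 0 ->
  (n * #|[set x | f.[x] ^+ e == w]| <= #|F| + B)%N.
Proof.
move=> sf w0; set z := #|_|.
have c4 : (4 <= c)%N by apply: leq_trans len2c; rewrite -[4%N]/(2 ^ 2)%N leq_sqr.
have n4 : (n ^ 4 * J ^ 2 <= #|F|)%N.
  by rewrite cardF2 expnMn leq_mul2r (expnM n 2 2) leq_sqr len2c orbT.
have nJ4 : (J <= n * J - 4)%N by nia.
have n3 : (n * (n * J * (J + n.+1 * (n * J))) <= 2 * (n ^ 4 * J ^ 2))%N.
  have -> : (n * (n * J * (J + n.+1 * (n * J))) = (n ^ 2 * J ^ 2) * (n ^ 2 + n + 1))%N by ring.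
  have -> : (2 * (n ^ 4 * J ^ 2) = (n ^ 2 * J ^ 2) * (2 * n ^ 2))%N by ring.
  by rewrite leq_mul2l; apply/orP; right; nia.
have qbig : (16 * n ^ 4 <= #|F|)%N.
  by apply: leq_trans n4; rewrite mulnC leq_mul2l -[16%N]/(4 ^ 2)%N leq_sqr le4J orbT.
have n44 : (8 * n <= n ^ 4)%N.
  have -> : (n ^ 4 = n ^ 3 * n)%N by ring.
  by rewrite leq_mul2r -[8%N]/(2 ^ 3)%N leq_exp2r // le2n orbT.
have e1 : (1 < e)%N by clear -cardF qbig n44 le2n; nia.
have nJq : (n.+1 * (n * J) <= #|F|)%N.
  apply: leq_trans n4; have -> : (n ^ 4 * J ^ 2 = (n ^ 3 * J) * (n * J))%N by ring.
  rewrite leq_mul2r; apply/orP; right; apply: (@leq_trans (n ^ 3)%N).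
    by rewrite (_ : (n ^ 3 = n * n * n)%N); [clear -le2n; nia | ring].
  by rewrite -{1}[(n ^ 3)%N]muln1 leq_mul2l; apply/orP; right; lia.
have := @stepanov_bound F n e f w cardF sf (n * J - 4) J e.-1.
move=> /(_ _ _ w0) st.
have {st} : (z * (n * J - 4) <= e.-1 + #|F| * J.-1 + n.+1 * (n * J - 4 + e * n.-1))%N.
  apply: st.
  - by rewrite prednK // ltnW.
  - by apply: leq_trans nJq; rewrite mulSn; lia.
  - by lia.
  have : (n * ((n * J - 4) * (J + n.+1 * (n * J - 4))) <= 2 * (n ^ 4 * J ^ 2))%N.
    apply: leq_trans n3; rewrite leq_mul2l; apply/orP; right.
    by apply: leq_mul; [lia | rewrite leq_add2l leq_mul2l; lia].
  set m := (n * J - 4)%N; have -> : (n * J = m + 4)%N by rewrite /m; lia.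
  (* The 4 subtracted in M leaves a slack of 4 (e - 1) between unknowns and equations; n^4 J^2 <=
     |F| makes it sufficient. *)
  move=> h; have h4 : (m * (J + n.+1 * m) < 4 * e.-1)%N.
    rewrite -(@ltn_pmul2l n); last exact: ltnW.
    have -> : (n * (4 * e.-1) = 4 * (n * e) - 4 * n)%N.
      by case: (e) e1 => // e' _; rewrite /= mulnS; lia.
    apply: leq_ltn_trans h _; clear -cardF n4 qbig n44 le2n; lia.
  rewrite (_ : m * (J + e.-1 + n.+1 * m) = m * (J + n.+1 * m) + m * e.-1)%N; last ring.
  by rewrite [((m + 4) * _)%N]mulnDl addnC ltn_add2l.
move=> h.
have : (z * (n * J - 4) <= #|F| * (J + n + 1))%N.
  apply: leq_trans h _.
  have a1 : (e.-1 <= #|F|)%N.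
    by apply: leq_trans (leq_pred e) _; rewrite -cardF; apply/leqW/leq_pmull; lia.
  have a2 : (n.+1 * (n * J - 4) <= #|F|)%N.
    by apply: leq_trans nJq; rewrite leq_mul2l leq_subr orbT.
  have a3 : (n.+1 * (e * n.-1) <= #|F| * n)%N by rewrite -cardF; clear; case: n => [|m]; rewrite ?muln0 //=; nia.
  have : (#|F| * J.-1 + #|F| = #|F| * J)%N by rewrite -mulnSr prednK //; lia.
  by rewrite !mulnDr muln1; clear -a1 a2 a3; lia.
move=> h1.
have h2 : (n * z * (n * J - 4) <= #|F| * (n * J - 4) + #|F| * (n ^ 2 + n + 4))%N.
  rewrite -mulnA; apply: leq_trans (leq_mul (leqnn n) h1) _.
  by rewrite -mulnDr mulnCA leq_mul2l; apply/orP; right; clear -le2n le4J nJ4; nia.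
(* Now (n z - |F|) (n J - 4) <= |F| (n^2 + n + 4). Since n J - 4 >= J and |F| = c^2 J^2, dividing by
   J leaves [B]. *)
rewrite -leq_subLR -(@leq_pmul2r J); last by lia.
apply: (@leq_trans ((n * z - #|F|) * (n * J - 4))%N); first by rewrite leq_mul2l nJ4 orbT.
apply: (@leq_trans (#|F| * (n ^ 2 + n + 4))%N); first by rewrite mulnBl leq_subLR.
by rewrite /B cardF2; apply: eq_leq; ring.
Qed.
End CrudeBound.

Section CrudeCharacterSum.
Variables (F : finFieldType) (n e c J : nat).
Hypotheses (cardF : (n * e).+1 = #|F|) (cardF2 : #|F| = ((c * J) ^ 2)%N).
Hypotheses (le2n : (2 <= n)%N) (le4J : (4 <= J)%N) (len2c : (n ^ 2 <= c)%N).
Let B := (c ^ 2 * (n ^ 2 + n + 4) * J)%N.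

Let W := [set w : F | w ^+ n == 1].

Let e_gt0 : (0 < e)%N.
Proof. by rewrite lt0n; apply/eqP => e0; have := finNzRing_gt1 F; rewrite -cardF e0 muln0. Qed.

Let W_neq0 w : w \in W -> w != 0.
Proof. by rewrite inE; apply: contraTneq => ->; rewrite expr0n; case: (n) le2n => //= ? _; rewrite eq_sym oner_eq0. Qed.

Let expf_ne (x : F) : x != 0 -> x ^+ (n * e) = 1.
Proof. by move=> x0; rewrite -[(n * e)%N]/((n * e).+1.-1) cardF expf_card_pred. Qed.

Lemma sum_power_fibers (V : nmodType) (phi : F -> V) (g : F -> F) :
  \sum_(x | g x != 0) phi (g x ^+ e) =
  \sum_(w in W) phi w *+ #|[set x | g x ^+ e == w]|.
Proof.
rewrite (partition_big (fun x => g x ^+ e) (mem W)) /=; last first.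
  by move=> x gx; rewrite inE -exprM mulnC expf_ne.
apply: eq_bigr => w wW; rewrite -sumr_const.
rewrite (eq_bigr (fun=> phi w)) => [|x /andP[_ /eqP->] //].
apply: eq_bigl => x; rewrite inE; have [gx|] := eqVneq (g x) 0; last by [].
by rewrite gx /= expr0n eqn0Ngt e_gt0 eq_sym (negPf (W_neq0 wW)).
Qed.

Lemma card_roots_of_unity : (#|W| <= n)%N.
Proof.
have n0 : (0 < n)%N by apply: ltnW.
have nz : ('X^n - 1 : {poly F}) != 0 by rewrite -size_poly_eq0 size_XnsubC.
have := max_poly_roots nz (rs := enum W); rewrite size_XnsubC // -cardE ltnS.
apply; last exact: enum_uniq.
by apply/allP => x; rewrite mem_enum inE rootE !hornerE subr_eq0.
Qed.

Variables (chi psi : F -> algC).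
Hypotheses (chiP : mulchar chi) (chiN : nontrivial chi).
Hypothesis chi_psi : forall z, z != 0 -> chi z = psi (z ^+ e).

(* The fibres of x |-> f(x)^e are compared with those of z |-> z^e, for which the
   character sum vanishes.  All of them have at most (|F| + B) / n points, and
   their total sizes are |F| - O(1), so upper bounds suffice. *)
Lemma csum3_crude c1 c2 c3 : `|csum3 chi c1 c2 c3| <= (2 * B + 4)%:R.
Proof.
case: (chiP) => chi0 chi1 chiM.
(* The n-th powers of nonzero elements lie in the kernel of chi, so dividing by x - c3 amounts to
   multiplying by (x - c3)^(n - 1). *)
pose f := ('X - c1%:P) * ('X - c2%:P) * ('X - c3%:P) ^+ n.-1 : {poly F}.
have fE x : f.[x] = (x - c1) * (x - c2) * (x - c3) ^+ n.-1.
  by rewrite /f !hornerE.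
have sf : size f = n.+2.
  have XC0 a : 'X - a%:P != 0 :> {poly F} by rewrite polyXsubC_eq0.
  rewrite /f size_mul ?mulf_neq0 ?expf_neq0 // size_mul // !size_XsubC size_exp_XsubC.
  by rewrite /= prednK // ltnW.
have sumE (g : F -> F) : \sum_x chi (g x) = \sum_(w in W) psi w *+ #|[set x | g x ^+ e == w]|.
  rewrite -sum_power_fibers (bigID (fun x => g x == 0)) /= big1 ?add0r => [|x /eqP->//].
  by apply: eq_bigr => x gx; rewrite chi_psi.
have csumE : csum3 chi c1 c2 c3 = \sum_x chi f.[x].
  apply: eq_bigr => x _; rewrite fE.
  have [->|x3] := eqVneq x c3.
    rewrite subrr invr0 mulr0 expr0n; case: (n) le2n => [|[|m]] //= _.
    by rewrite mulr0.
  have x30 : x - c3 != 0 by rewrite subr_eq0.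
  have cn : chi ((x - c3) ^+ n) = 1.
    by rewrite chi_psi ?expf_neq0 // -exprM expf_ne // -(expr1n F e) -chi_psi ?oner_eq0.
  rewrite -[LHS]mulr1 -cn -chiM; congr chi.
  rewrite -[LHS]mulrA; congr (_ * _); case: (n) le2n => // m _; rewrite exprS mulKf //.
pose Nf w := #|[set x | f.[x] ^+ e == w]|; pose Nz w := #|[set x : F | x ^+ e == w]|.
have -> : csum3 chi c1 c2 c3 = \sum_(w in W) psi w * ((Nf w)%:R - (Nz w)%:R).
  rewrite csumE -[LHS]subr0 -[X in _ - X](sum_mulchar chiP chiN) sumE (sumE id) -sumrB.
  by apply: eq_bigr => w _; rewrite mulrBr !mulr_natr.
apply: (@le_trans _ _ (\sum_(w in W) (`|Nf w - Nz w|%N)%:R)).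
  apply: le_trans (ler_norm_sum _ _ _) _; apply: ler_sum => w wW.
  (* The function psi is controlled only at e-th powers; at any other w both counts are 0. *)
  have hw z : z ^+ e = w -> `|psi w| = 1.
    move=> zw; have z0 : z != 0.
      by apply: contraNneq (W_neq0 wW) => z0; rewrite -zw z0 expr0n eqn0Ngt e_gt0.
    by rewrite -zw -chi_psi // (mulchar_norm chiP).
  have aux : `|(Nf w)%:R - (Nz w)%:R| = (`|Nf w - Nz w|%N)%:R :> algC.
    by rewrite natr_absz intr_norm rmorphB /= !pmulrn.
  have [Nf0|/card_gt0P[x]] := posnP (Nf w).
    have [Nz0|/card_gt0P[x]] := posnP (Nz w).
      by rewrite Nf0 Nz0 subrr mulr0 normr0.
    by rewrite inE => /eqP /hw h; rewrite normrM h mul1r aux.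
  by rewrite inE => /eqP /hw h; rewrite normrM h mul1r aux.
rewrite -natr_sum ler_nat.
have sN (g : F -> F) : (\sum_(w in W) #|[set x | (g x ^+ e)%R == w]| = #|[set x : F | g x != 0%R]|)%N.
  have := @sum_power_fibers nat (fun=> 1%N) g.
  rewrite sum1_card => h.
  rewrite [RHS](eq_card (B := [pred x | g x != 0])); last by move=> x; rewrite !inE.
  by rewrite h; apply: eq_bigr => w _; rewrite natn.
have sNf : (#|F| - 3 <= \sum_(w in W) Nf w)%N.
  rewrite sN leq_subLR -[X in (X <= _)%N]cardsT.
  apply: (@leq_trans #|[set c1; c2; c3] :|: [set x | f.[x] != 0]|).
    apply/subset_leq_card/subsetP => x _; rewrite !inE fE !mulf_eq0 !subr_eq0.
    case: eqP => //= _; case: eqP => //= _; case: eqP => //= /eqP x3.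
    by rewrite expf_neq0 // subr_eq0.
  apply: leq_trans (leq_card_setU _ _) _; rewrite leq_add2r.
  by apply: leq_trans (leq_card_setU _ _) _; rewrite cards1 cards2; case: (_ != _).
have sNz : (#|F| - 1 <= \sum_(w in W) Nz w)%N.
  rewrite (sN id) leq_subLR (cardD1 0 F) inE leq_add2l.
  by apply/subset_leq_card/subsetP => x; rewrite !inE andbT.
have q3 : (3 <= #|F|)%N by rewrite -cardF; nia.
(* Since |a - b| + a + b = 2 max(a, b), each summand is at most 2 (|F| + B) / n. Over at most n
   values of w, removing the totals |F| - 3 and |F| - 1 leaves 2 B + 4. *)
have bound : (n * (\sum_(w in W) (`|Nf w - Nz w|%N + Nf w + Nz w)) <= n * (2 * (#|F| + B)))%N.
  rewrite big_distrr /=.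
  apply: (@leq_trans (\sum_(w in W) (2 * (#|F| + B)))%N).
    apply: leq_sum => w wW.
    have := stepanov_count cardF cardF2 le2n le4J len2c sf (W_neq0 wW).
    have : (n * Nz w <= #|F| + B)%N.
      apply: (@leq_trans (n * e)%N); last by rewrite -cardF; apply/leqW/leq_addr.
      rewrite leq_mul2l; apply/orP; right.
      have nz : ('X^e - w%:P : {poly F}) != 0 by rewrite -size_poly_eq0 size_XnsubC.
      have := max_poly_roots nz (rs := enum [set x | x ^+ e == w]).
      rewrite size_XnsubC // -cardE ltnS; apply; last exact: enum_uniq.
      by apply/allP => x; rewrite mem_enum inE rootE !hornerE subr_eq0.
    rewrite -/B -/(Nf w); lia.
  rewrite sum_nat_const leq_mul2r card_roots_of_unity orbT //.
move: bound; rewrite leq_pmul2l; last exact: ltnW.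
rewrite !big_split /=; move: sNf sNz q3.
move: (\sum_(w in W) Nf w)%N (\sum_(w in W) Nz w)%N (\sum_(i in W) `|Nf i - Nz i|)%N.
move: #|F| B => q b; clear; lia.
Qed.
End CrudeCharacterSum.

(** * Square-root cancellation *)

(* The invariant along the tower of quadratic extensions; z ^+ e is the norm of z
   to the prime field when n = p - 1. *)
Definition large_csum3 (n q m : nat) : Prop :=
  exists (F : finFieldType) (chi psi : F -> algC) (c1 c2 c3 : F) (e : nat),
    [/\ #|F| = q, (2 : F) != 0 & (n * e).+1 = q] /\
    [/\ mulchar chi, nontrivial chi & forall z, z != 0 -> chi z = psi (z ^+ e)] /\
    [/\ c1 != c2, c1 != c3, c2 != c3 & (m * q)%:R <= `|csum3 chi c1 c2 c3| ^+ 2].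

(** Doubling gives |S'| >= (m - 2) q, and (m - 2)^2 >= m + 1. *)
Lemma large_csum3_step n q m : (9 <= m)%N ->
  large_csum3 n q m -> large_csum3 n (q ^ 2) m.+1.
Proof.
move=> m9 [F [chi [psi [c1 [c2 [c3 [e]]]]]]] [[cF F2 ne] [[chiP chiN chi_psi] [c12 c13 c23 big]]].
(* The new exponent is e (q + 1): z^(q + 1) is the image of the norm, and [pull], a left inverse of
   [iota], transports psi to K. *)
have [K [iota cK]] := quad_ext F2.
pose pull (w : K) : F := odflt 0 [pick x | iota x == w].
have pullK x : pull (iota x) = x.
  rewrite /pull; case: pickP => [y /eqP/fmorph_inj //|/(_ x)]; by rewrite eqxx.
exists K, (chi \o Nm iota), (fun w => psi (pull w)), (iota c1), (iota c2), (iota c3).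
exists (e * q.+1)%N; split; [split|split; split].
- by rewrite cK cF.
- by rewrite -(rmorph_nat iota) fmorph_eq0.
- by rewrite mulnA; have -> : (n * e = q.-1)%N by [rewrite -ne]; case: (q) ne => // r _; lia.
- exact: mulchar_Nm.
- exact: nontrivial_Nm.
- move=> z z0 /=; rewrite chi_psi ?(Nm_eq0 iota cK) //; congr psi.
  rewrite -[LHS]pullK rmorphXn /= (iota_Nm iota cK) cF; congr pull.
  by rewrite -exprS -exprM mulnC.
- by rewrite (inj_eq (fmorph_inj iota)).
- by rewrite (inj_eq (fmorph_inj iota)).
- by rewrite (inj_eq (fmorph_inj iota)).
have := csum3_doubling iota cK chiP chiN c12 c13 c23.
set S := csum3 _ _ _ _ in big *; set S' := csum3 _ _ _ _; rewrite cF => dbl.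
have h : ((m - 2) * q)%:R <= `|S'|.
  rewrite -(lerD2r (2 * q)%:R) -natrD -mulnDl subnK; last by lia.
  exact: le_trans big dbl.
apply: (@le_trans _ _ (((m - 2) * q) ^ 2)%:R).
  by rewrite ler_nat expnMn leq_mul2r; apply/orP; right; nia.
by rewrite natrX lerXn2r ?nnegrE ?ler0n.
Qed.

Lemma large_csum3_iter n q k : large_csum3 n q 9 -> large_csum3 n (q ^ (2 ^ k)) (9 + k).
Proof.
move=> h; elim: k => [|k IH]; first by rewrite expn0 expn1 addn0.
by rewrite expnSr expnM addnS; apply: large_csum3_step; rewrite ?leq_addr.
Qed.

(** The crude bound yields |S|^2 <= (2 A + 1)^2 J^2 = k J^2 at every level that is high enough,
    whereas k + 3 doublings force |S|^2 >= (k + 12) q with q >= J^2. *)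
Lemma not_large_csum3 p : (3 <= p)%N -> ~ large_csum3 p.-1 p 9.
Proof.
move=> p3; pose n := p.-1; pose c := (p ^ 2)%N.
pose A := (c ^ 2 * (n ^ 2 + n + 4))%N; pose k := ((2 * A + 1) ^ 2)%N.
move=> /(large_csum3_iter k.+3).
set m := (9 + k.+3)%N; set q := (p ^ _)%N.
pose J := (p ^ (2 ^ k.+2 - 2))%N.
have qE : q = ((c * J) ^ 2)%N.
  rewrite /q /c /J -expnD subnKC; last by rewrite -[X in (X <= _)%N]/(2 ^ 1)%N leq_exp2l.
  by rewrite -expnM -expnSr.
have J4 : (4 <= J)%N.
  apply: (@leq_trans (p ^ 2)%N); first by rewrite -[4%N]/(2 ^ 2)%N leq_sqr ltnW.
  rewrite leq_exp2l; last by rewrite ltnW.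
  by rewrite -[X in (X <= _)%N]/(2 ^ 2 - 2)%N leq_sub2r // leq_exp2l.
move=> [F [chi [psi [c1 [c2 [c3 [e]]]]]]] [[cF F2 ne] [[chiP chiN chi_psi] [c12 c13 c23 big]]].
have n2 : (2 <= n)%N by rewrite /n; lia.
have nc : (n ^ 2 <= c)%N by rewrite leq_sqr leq_pred.
have cFe : (n * e).+1 = #|F| by rewrite cF.
have := csum3_crude cFe (etrans cF qE) n2 J4 nc chiP chiN chi_psi c1 c2 c3.
rewrite -/A => up.
have : (m * q)%:R <= (((2 * A + 1) * J) ^ 2)%:R :> algC.
  apply: le_trans big _; rewrite natrX lerXn2r ?nnegrE ?ler0n //.
  by apply: le_trans up _; rewrite ler_nat; lia.
rewrite ler_nat leqNgt => /negP; apply.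
rewrite expnMn -/k qE expnMn.
have c0 : (0 < c ^ 2)%N by rewrite !expn_gt0; lia.
have J0 : (0 < J ^ 2)%N by rewrite expn_gt0; lia.
apply: (@leq_trans (m * J ^ 2)%N); first by rewrite ltn_pmul2r // /m; lia.
by rewrite leq_mul2l leq_pmull ?orbT.
Qed.

Theorem csum3_bound (F : finFieldType) (chi : F -> algC) (c1 c2 c3 : F) :
  prime #|F| -> mulchar chi -> nontrivial chi ->
  c1 != c2 -> c1 != c3 -> c2 != c3 ->
  `|csum3 chi c1 c2 c3| ^+ 2 <= (9 * #|F|)%:R.
Proof.
move=> pF chiP chiN c12 c13 c23; set p := #|F|.
(* The field with two elements has 1 as its only unit, hence no nontrivial character. *)
have p3 : (3 <= p)%N.
  rewrite ltn_neqAle prime_gt1 // andbT; apply/eqP => p2.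
  case: chiN => x x0; apply/negP; rewrite negbK; case: chiP => _ <- _; apply/eqP.
  congr chi; apply/eqP; apply: contraT => x1.
  have : (#|[set 0%R; 1%R; x]| <= #|F|)%N by apply: max_card.
  rewrite -/p -p2 setUC cardsU1 cards2 !inE (negPf x0) (negPf x1).
  by rewrite eq_sym oner_eq0.
rewrite real_leNgt ?realX ?normr_real ?realn //; apply/negP => big.
(* Over the prime field the tower starts with psi = chi and e = 1. *)
apply: (not_large_csum3 p3); exists F, chi, chi, c1, c2, c3, 1%N.
split; [split|split; split] => //.
- apply: contraL pF => /eqP F2.
  have ch2 : 2%N \in [pchar F] by rewrite inE F2 eqxx.
  have : (2 %| p)%N.
    have := finNzRing_gt1 F; rewrite -/p /p (card_pprimeChar ch2).
    by case: logn => // i _; rewrite expnS dvdn_mulr.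
  move=> h; apply/negP => pp; move: p3; rewrite (eqP (_ : p == 2%N)) //.
  by rewrite eq_sym -dvdn_prime2.
- by rewrite muln1 prednK // ltnW // ltnW.
- exact: ltW.
Qed.

(** * Complete sums with two linear factors above and below *)

Section CompleteSums.
Variables (F : finFieldType) (chi : F -> algC).
Hypotheses (F_pr : prime #|F|) (chiP : mulchar chi) (chiN : nontrivial chi).

Let chi0 : chi 0 = 0. Proof. by case: chiP. Qed.
Let chi1 : chi 1 = 1. Proof. by case: chiP. Qed.
Let chiM : {morph chi : x y / x * y}. Proof. by case: chiP. Qed.
Let s : algC := sqrtC #|F|%:R.

Let s_ge1 : 1 <= s.
Proof. by rewrite -(sqrtC1 algC) ler_sqrtC ?nnegrE ?ler01 ?ler0n // ler1n; apply: ltnW; apply: prime_gt1. Qed.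

Lemma sum_mulchar_shift_ratio c d : c != d -> \sum_x chi ((x - c) / (x - d)) = -1.
Proof.
move=> cd; rewrite (reindex_inj (addIr c)) /=.
rewrite -(sum_mulchar_ratio chiP chiN (w := c - d)) ?subr_eq0 //.
by apply: eq_bigr => x _; rewrite addrK addrA.
Qed.

Lemma sum_mulchar_quotient c d :
  \sum_x chi ((x - c) / (x - d)) = (if c == d then #|F|%:R else 0) - 1.
Proof.
have [<-|cd] := eqVneq c d; last by rewrite sum_mulchar_shift_ratio // sub0r.
rewrite (bigD1 c) //= subrr mul0r chi0 add0r.
rewrite (eq_bigr (fun=> 1)) => [|x xc]; last by rewrite divff ?subr_eq0.
by rewrite sumr_const cardC1 -subn1 natrB // ltnW // finNzRing_gt1.
Qed.

(* |J d| is constant for d != 0, so its value follows from the second moment. *)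
Lemma norm_jacobi_sum c d : c != d -> `|\sum_x chi ((x - c) * (x - d))| <= s.
Proof.
pose J d := \sum_x chi (x * (x - d)).
have J1 e : e != 0 -> `|J e| = `|J 1|.
  move=> e0; rewrite /J (reindex_inj (mulfI e0)) /=.
  rewrite (eq_bigr (fun x => chi (e ^+ 2) * chi (x * (x - 1)))) => [|x _].
    by rewrite -mulr_sumr normrM (mulchar_norm chiP) ?mul1r // expf_neq0.
  by rewrite -chiM; congr chi; ring.
move=> cd; have -> : `|\sum_x chi ((x - c) * (x - d))| = `|J 1|.
  rewrite -(J1 (d - c)) ?subr_eq0 1?eq_sym // (reindex_inj (addIr c)) /=.
  by congr `|_|; apply: eq_bigr => x _; rewrite addrK opprB addrA.
have q1 : (0 < #|F|.-1)%N by have := prime_gt1 F_pr; case: #|F| => [|[]].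
(* After expanding the squares, the sum over e is [sum_mulchar_quotient]: the value |F| occurs at x
   = y, and the parts -1 add up to a multiple of the vanishing sum of chi y^-1. *)
have sumJ : \sum_e `|J e| ^+ 2 = (#|F| * #|F|.-1)%:R.
  have -> : \sum_e `|J e| ^+ 2 = \sum_x \sum_y chi (x / y) * \sum_e chi ((e - x) / (e - y)).
    rewrite (eq_bigr (fun e => \sum_x \sum_y chi (x / y) * chi ((e - x) / (e - y)))).
      rewrite exchange_big; apply: eq_bigr => x _ /=.
      by rewrite exchange_big; apply: eq_bigr => y _ /=; rewrite mulr_sumr.
    move=> e _; rewrite normCK rmorph_sum big_distrlr /=; apply: eq_bigr => x _.
    apply: eq_bigr => y _; rewrite -(mulcharV chiP) -!chiM; congr chi.
    by rewrite -(opprB e x) -(opprB e y) !mulrN invrN mulrNN mulf_div.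
  have -> : \sum_x \sum_y chi (x / y) * \sum_e chi ((e - x) / (e - y)) =
     \sum_x (chi (x / x) * #|F|%:R - chi x * \sum_y chi y^-1).
    apply: eq_bigr => x _; rewrite mulr_sumr (bigD1 x) //= [X in _ = _ - X](bigD1 x) //=.
    rewrite sum_mulchar_quotient eqxx mulrBr mulr1 opprD addrA -chiM; congr (_ + _).
    rewrite -sumrN; apply: eq_bigr => y yx.
    by rewrite sum_mulchar_quotient eq_sym (negPf yx) sub0r mulrN1 -chiM.
  rewrite (eq_bigr (fun x => chi (x / x) * #|F|%:R)) => [|x _]; last first.
    have -> : \sum_y chi y^-1 = 0.
      by rewrite -[RHS](sum_mulcharV_shift chiP chiN 0); apply: eq_bigr => y _; rewrite subr0.
    by rewrite mulr0 subr0.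
  rewrite -mulr_suml mulrC natrM; congr (_ * _).
  rewrite (bigD1 0) //= mul0r chi0 add0r (eq_bigr (fun=> 1)) => [|x x0]; last by rewrite divff.
  by rewrite sumr_const cardC1.
have : (#|F|.-1)%:R * `|J 1| ^+ 2 <= (#|F|.-1)%:R * #|F|%:R.
  rewrite -natrM mulnC -sumJ (bigD1 0) //=.
  rewrite (eq_bigr (fun=> `|J 1| ^+ 2)) => [|e e0]; last by rewrite J1.
  by rewrite sumr_const cardC1 mulr_natl lerDr exprn_ge0.
rewrite ler_pM2l ?ltr0n // => h.
by rewrite -(ler_pXn2r (n := 2)) ?nnegrE ?normr_ge0 ?sqrtC_ge0 ?ler0n // sqrtCK.
Qed.

Definition csum22 c1 c2 c3 c4 := \sum_x chi ((x - c1) * (x - c2) / ((x - c3) * (x - c4))).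

Lemma csum22_conj c1 c2 c3 c4 : (csum22 c1 c2 c3 c4)^* = csum22 c3 c4 c1 c2.
Proof.
rewrite /csum22 rmorph_sum; apply: eq_bigr => x _ /=.
by rewrite -(mulcharV chiP) invf_div.
Qed.

Lemma csum22C1 c1 c2 c3 c4 : csum22 c1 c2 c3 c4 = csum22 c2 c1 c3 c4.
Proof. by apply: eq_bigr => x _; rewrite [(x - c1) * _]mulrC. Qed.

Lemma csum22C2 c1 c2 c3 c4 : csum22 c1 c2 c3 c4 = csum22 c1 c2 c4 c3.
Proof. by apply: eq_bigr => x _; rewrite [(x - c3) * _]mulrC. Qed.

(** Cancelling x - c leaves a ratio sum equal to -1, up to the one term at x = c. *)
Lemma norm_csum22_cancel c c2 c4 : c2 != c4 -> `|csum22 c c2 c c4| <= 4 * s.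
Proof.
move=> c24; have := sum_mulchar_shift_ratio c24; rewrite (bigD1 c) //= => h.
rewrite /csum22 (bigD1 c) //= subrr !mul0r chi0 add0r.
have -> : \sum_(x | x != c) chi ((x - c) * (x - c2) / ((x - c) * (x - c4))) =
     -1 - chi ((c - c2) / (c - c4)).
  rewrite -h addrAC subrr add0r; apply: eq_bigr => x xc; rewrite -mulf_div divff ?mul1r //.
  by rewrite subr_eq0.
apply: le_trans (ler_normB _ _) _; rewrite normrN1.
apply: (@le_trans _ _ (1 + 1)); first by rewrite lerD2l mulchar_norm_le1.
by apply: (@le_trans _ _ (4 * 1)); rewrite ?ler_pM2l // mulr1 -[1 + 1]/(2%:R) ler_nat.
Qed.

Lemma shift_inv_inj (c : F) : injective (fun y => c + y^-1).
Proof. by move=> x y /addrI/invr_inj. Qed.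

(* The substitution x = c + y^-1 moves c to infinity; as 0^-1 = 0 it is a
   bijection of F, in which y = 0 gives the term x = c. *)
Lemma inv_shiftE (d y : F) : d != 0 -> y != 0 -> d + y^-1 = d * (y - - d^-1) / y.
Proof. by move=> d0 y0; rewrite opprK mulrDr mulfV // mulrDl mul1r mulfK. Qed.

(** With the double zero c moved to infinity, a conjugate Jacobi sum without its term at y = 0
    remains, of modulus at most s + 1. *)
Lemma norm_csum22_double c c3 c4 : c != c3 -> c != c4 -> c3 != c4 -> `|csum22 c c c3 c4| <= 4 * s.
Proof.
rewrite -(subr_eq0 c c3) -(subr_eq0 c c4) => d3 d4 c34.
have e34 : - (c - c3)^-1 != - (c - c4)^-1.
  by rewrite (inj_eq (@oppr_inj F)) (inj_eq (@invr_inj F)) (inj_eq (addrI c)) (inj_eq (@oppr_inj F)).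
have -> : csum22 c c c3 c4 = chi ((c - c3) * (c - c4))^-1 *
    ((\sum_y chi ((y - - (c - c3)^-1) * (y - - (c - c4)^-1)))^* -
     chi ((0 - - (c - c3)^-1) * (0 - - (c - c4)^-1))^-1).
  rewrite /csum22 (reindex_inj (@shift_inv_inj c)) (bigD1 0) //= invr0 addr0 subrr !mul0r chi0 add0r.
  have -> : (\sum_y chi ((y - - (c - c3)^-1) * (y - - (c - c4)^-1)))^* =
      \sum_y chi ((y - - (c - c3)^-1) * (y - - (c - c4)^-1))^-1.
    by rewrite rmorph_sum; apply: eq_bigr => y _; rewrite (mulcharV chiP).
  rewrite [X in _ * (X - _)](bigD1 0) //= addrAC subrr add0r mulr_sumr.
  apply: eq_bigr => y y0; rewrite -chiM; congr chi.
  rewrite addrAC subrr add0r ![c + _ - _]addrAC !inv_shiftE //.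
  set u := y - _; set v := y - _.
  rewrite (_ : (c - c3) * u / y * ((c - c4) * v / y) =
     ((c - c3) * (c - c4) * (u * v)) * (y^-1 / y)); last by ring.
  by rewrite invfM mulrCA divff ?mulr1 ?mulf_neq0 ?invr_eq0 // invfM.
rewrite normrM (mulchar_norm chiP) ?invr_eq0 ?mulf_neq0 // mul1r.
apply: le_trans (ler_normB _ _) _; rewrite norm_conjC.
apply: (@le_trans _ _ (s + 1)); first by rewrite lerD ?mulchar_norm_le1 ?norm_jacobi_sum.
apply: (@le_trans _ _ (s + s)); first by rewrite lerD2l.
rewrite -mulr2n; apply: (@le_trans _ _ (2%:R * s)); first by rewrite mulr_natl.
by rewrite ler_wpM2r ?ler_nat // (le_trans ler01 s_ge1).
Qed.

(** With c4 moved to infinity, a [csum3] without its term at y = 0 remains, of modulus at most 3 s +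
    1. *)
Lemma norm_csum22_distinct c1 c2 c3 c4 : uniq [:: c1; c2; c3; c4] -> `|csum22 c1 c2 c3 c4| <= 4 * s.
Proof.
rewrite /= !inE !negb_or => /and4P[/and3P[c12 c13 c14] /andP[c23 c24] c34 _].
have d1 : c4 - c1 != 0 by rewrite subr_eq0 eq_sym.
have d2 : c4 - c2 != 0 by rewrite subr_eq0 eq_sym.
have d3 : c4 - c3 != 0 by rewrite subr_eq0 eq_sym.
have neq a b : a != b -> - (c4 - a)^-1 != - (c4 - b)^-1.
  by rewrite (inj_eq (@oppr_inj F)) (inj_eq (@invr_inj F)) (inj_eq (addrI c4)) (inj_eq (@oppr_inj F)).
pose e i := - (c4 - i)^-1.
have -> : csum22 c1 c2 c3 c4 = chi ((c4 - c1) * (c4 - c2) / (c4 - c3)) *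
    (csum3 chi (e c1) (e c2) (e c3) - chi ((0 - e c1) * (0 - e c2) / (0 - e c3))).
  rewrite /csum22 (reindex_inj (@shift_inv_inj c4)) (bigD1 0) //= invr0 addr0.
  rewrite subrr !mulr0 invr0 mulr0 chi0 add0r.
  rewrite /csum3 [X in _ * (X - _)](bigD1 0) //= addrAC subrr add0r mulr_sumr.
  apply: eq_bigr => y y0; rewrite -chiM; congr chi.
  have -> : c4 + y^-1 - c4 = y^-1 by rewrite addrAC subrr add0r.
  rewrite ![c4 + _ - _]addrAC !inv_shiftE // -/(e c1) -/(e c2) -/(e c3).
  set u := y - e c1; set v := y - e c2; set w := y - e c3.
  rewrite (_ : (c4 - c1) * u / y * ((c4 - c2) * v / y) =
     (y^-1 / y) * ((c4 - c1) * (c4 - c2) * (u * v))); last by ring.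
  rewrite (_ : (c4 - c3) * w / y * y^-1 = (y^-1 / y) * ((c4 - c3) * w)); last by ring.
  by rewrite -mulf_div divff ?mulf_neq0 ?invr_eq0 // mul1r mulf_div.
rewrite normrM (mulchar_norm chiP) ?mul1r ?mulf_neq0 ?invr_eq0 //.
apply: le_trans (ler_normB _ _) _.
have c3s : `|csum3 chi (e c1) (e c2) (e c3)| <= 3 * s.
  rewrite -(ler_pXn2r (n := 2)) ?nnegrE ?normr_ge0 ?mulr_ge0 ?sqrtC_ge0 ?ler0n //.
  by rewrite exprMn sqrtCK -natrX -natrM csum3_bound ?neq.
apply: (@le_trans _ _ (3 * s + 1)); first by rewrite lerD ?mulchar_norm_le1.
apply: (@le_trans _ _ (3 * s + s)); first by rewrite lerD2l.
by rewrite (_ : 3 * s + s = 4 * s) //; ring.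
Qed.

(** In the excluded patterns the quotient is 1 or a square away from its zeros and poles, and a
    quadratic character does not oscillate on it. *)
Lemma norm_csum22 c1 c2 c3 c4 :
  ~~ [|| (c1 == c3) && (c2 == c4), (c1 == c4) && (c2 == c3) | (c1 == c2) && (c3 == c4)] ->
  `|csum22 c1 c2 c3 c4| <= 4 * s.
Proof.
rewrite !negb_or !negb_and => /and3P[h1 h2 h3].
have [e13|n13] := eqVneq c1 c3.
  by rewrite e13 eqxx /= in h1 *; apply: norm_csum22_cancel.
have [e14|n14] := eqVneq c1 c4.
  by rewrite e14 eqxx /= in h2 *; rewrite csum22C2; apply: norm_csum22_cancel.
have [e23|n23] := eqVneq c2 c3.
  by rewrite e23 csum22C1; apply: norm_csum22_cancel.
have [e24|n24] := eqVneq c2 c4.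
  by rewrite e24 csum22C1 csum22C2; apply: norm_csum22_cancel.
have [e12|n12] := eqVneq c1 c2.
  rewrite e12 eqxx /= in h3 n14 *; exact: norm_csum22_double.
have [e34|n34] := eqVneq c3 c4.
  rewrite -norm_conjC csum22_conj e34; apply: norm_csum22_double => //; by rewrite eq_sym.
by apply: norm_csum22_distinct; rewrite /= !inE !negb_or n12 n13 n14 n23 n24 n34.
Qed.

End CompleteSums.

(** Lagrange's identity; nonnegativity of f and g makes the differences real, so their squares are
    nonnegative. *)
Lemma cauchy_schwarz_sum (R : numFieldType) (I : finType) (P : pred I) (f g : I -> R) :
  (forall i, 0 <= f i) -> (forall i, 0 <= g i) ->
  (\sum_(i | P i) f i * g i) ^+ 2 <=
  (\sum_(i | P i) f i ^+ 2) * (\sum_(i | P i) g i ^+ 2).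
Proof.
move=> f0 g0; rewrite -subr_ge0.
have : 0 <= \sum_(i | P i) \sum_(j | P j) (f i * g j - f j * g i) ^+ 2.
  apply: sumr_ge0 => i _; apply: sumr_ge0 => j _; rewrite real_exprn_even_ge0 //.
  by rewrite rpredB // realM // ger0_real.
have -> : \sum_(i | P i) \sum_(j | P j) (f i * g j - f j * g i) ^+ 2 =
   ((\sum_(i | P i) f i ^+ 2) * (\sum_(i | P i) g i ^+ 2) -
   (\sum_(i | P i) f i * g i) ^+ 2) *+ 2.
  have e1 : (\sum_(i | P i) f i ^+ 2) * (\sum_(i | P i) g i ^+ 2) =
      \sum_(i | P i) \sum_(j | P j) f i ^+ 2 * g j ^+ 2 by rewrite big_distrlr.
  have e2 : (\sum_(i | P i) f i ^+ 2) * (\sum_(i | P i) g i ^+ 2) =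
      \sum_(i | P i) \sum_(j | P j) f j ^+ 2 * g i ^+ 2.
    by rewrite e1 exchange_big.
  have e3 : (\sum_(i | P i) f i * g i) ^+ 2 =
      \sum_(i | P i) \sum_(j | P j) (f i * g i) * (f j * g j) by rewrite expr2 big_distrlr.
  rewrite mulr2n {1}e1 e2 e3 -!sumrB -big_split; apply: eq_bigr => i _ /=.
  by rewrite -!sumrB -big_split; apply: eq_bigr => j _ /=; ring.
by rewrite pmulrn_lge0.
Qed.

(** * Fourth moments and bilinear sums *)

Section FourthMoment.
Variables (F : finFieldType) (chi : F -> algC).
Hypotheses (F_pr : prime #|F|) (chiP : mulchar chi) (chiN : nontrivial chi).
Let s : algC := sqrtC #|F|%:R.
Let chiM : {morph chi : x y / x * y}. Proof. by case: chiP. Qed.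

Variable B : {set F}.
Let P (u : F * F) := (u.1 \in B) && (u.2 \in B).

Let diagonal (u v : F * F) : bool :=
  [|| (u.1 == v.1) && (u.2 == v.2), (u.1 == v.2) && (u.2 == v.1)
    | (u.1 == u.2) && (v.1 == v.2)].

Lemma card_pairs : (\sum_(u | P u) 1 = #|B| ^ 2)%N.
Proof.
rewrite -(pair_big (mem B) (mem B) (fun _ _ => 1%N)) /= sum_nat_const.
by rewrite sum1_card mulnn.
Qed.

(** In the first two patterns u determines v; the third leaves one free element of B on each
    side. *)
Lemma card_diagonal : (\sum_(u | P u) \sum_(v | P v) diagonal u v <= 3 * #|B| ^ 2)%N.
Proof.
have cnt (T : finType) (Q : pred T) (w : T) : (\sum_(v | Q v) (v == w) <= 1)%N.
  rewrite big_mkcond (bigD1 w) //= big1 ?addn0 => [|v /negPf->]; last by case: ifP.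
  by rewrite eqxx; case: ifP.
apply: (@leq_trans (\sum_(u | P u) \sum_(v | P v)
   ((v == u) + (v == (u.2, u.1)) + (u.1 == u.2) * (v.1 == v.2))))%N.
  apply: leq_sum => -[u1 u2] _; apply: leq_sum => -[v1 v2] _; rewrite /diagonal /= !xpair_eqE.
  rewrite [v1 == u1]eq_sym [v2 == u2]eq_sym [v1 == u2]eq_sym [v2 == u1]eq_sym.
  by do 6!case: (_ == _).
have diag : (\sum_(u | P u) (u.1 == u.2) <= #|B|)%N.
  rewrite -(pair_big (mem B) (mem B) (fun b1 b2 : F => nat_of_bool (b1 == b2))) /=.
  rewrite -sum1_card; apply: leq_sum => b _.
  rewrite (eq_bigr (fun b2 => nat_of_bool (b2 == b))); first exact: cnt.
  by move=> b2 _; rewrite eq_sym.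
rewrite (eq_bigr (fun u => \sum_(v | P v) (v == u) + \sum_(v | P v) (v == (u.2, u.1)) +
   (u.1 == u.2) * \sum_(v | P v) (v.1 == v.2)))%N => [|u _]; last first.
  by rewrite !big_split /= big_distrr.
rewrite !big_split /= -big_distrl /=.
rewrite (_ : 3 * #|B| ^ 2 = #|B| ^ 2 + #|B| ^ 2 + #|B| * #|B|)%N; last by ring.
apply: leq_add; last exact: leq_mul.
by rewrite -card_pairs; apply: leq_add; apply: leq_sum => u _; apply: cnt.
Qed.

(** Diagonal quadruples contribute at most 3 |F| |B|^2. The |B|^4 bounds 4 s add up to at most 16
    |F| |B|^2, as the hypothesis means |B|^2 <= 4 s. *)
Lemma fourth_moment : (#|B| ^ 4 <= 16 * #|F|)%N ->
  \sum_x `|\sum_(b in B) chi (x + b)| ^+ 4 <= (19 * #|F| * #|B| ^ 2)%:R.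
Proof.
move=> hB; set S := \sum_x _.
have s2 : s ^+ 2 = #|F|%:R by rewrite sqrtCK.
have s0 : 0 <= s by rewrite sqrtC_ge0 ler0n.
have SE : S = \sum_(u | P u) \sum_(v | P v) csum22 chi (- u.1) (- u.2) (- v.1) (- v.2).
  rewrite /csum22 (eq_bigr (fun u => \sum_x \sum_(v | P v)
     chi ((x + u.1) * (x + u.2) / ((x + v.1) * (x + v.2))))); last first.
    move=> u _; rewrite exchange_big; apply: eq_bigr => v _ /=.
    by apply: eq_bigr => x _; rewrite !opprK.
  rewrite exchange_big; apply: eq_bigr => x _ /=.
  rewrite (exprM _ 2 2) -normrX normCK.
  have -> : (\sum_(b in B) chi (x + b)) ^+ 2 = \sum_(u | P u) chi ((x + u.1) * (x + u.2)).
    rewrite expr2 big_distrlr pair_big /=; apply: eq_bigr => u _.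
    by rewrite chiM.
  rewrite rmorph_sum big_distrlr /=; apply: eq_bigr => u _; apply: eq_bigr => v _.
  by rewrite -(mulcharV chiP) -chiM.
have S0 : 0 <= S by apply: sumr_ge0 => x _; rewrite exprn_ge0.
rewrite -(ger0_norm S0) SE.
apply: (@le_trans _ _ (\sum_(u | P u) \sum_(v | P v) (4 * s + #|F|%:R * (diagonal u v)%:R))).
  apply: le_trans (ler_norm_sum _ _ _) _; apply: ler_sum => u _.
  apply: le_trans (ler_norm_sum _ _ _) _; apply: ler_sum => v _.
  have [d|d] := boolP (diagonal u v).
    apply: (@le_trans _ _ #|F|%:R); last by rewrite mulr1 lerDr mulr_ge0.
    rewrite /csum22 -sum1_card natr_sum; apply: le_trans (ler_norm_sum _ _ _) _.
    by apply: ler_sum => x _; apply: mulchar_norm_le1.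
  rewrite mulr0 addr0; apply: norm_csum22 => //; move: d.
  by rewrite /diagonal !(inj_eq (@oppr_inj F)).
rewrite (eq_bigr (fun u => \sum_(v | P v) 4 * s + #|F|%:R * (\sum_(v | P v) diagonal u v)%N%:R));
  last by move=> u _; rewrite big_split /= natr_sum mulr_sumr.
rewrite big_split /= -[X in _ + X]mulr_sumr -natr_sum.
have -> : \sum_(u | P u) \sum_(v | P v) 4 * s = (#|B| ^ 2)%:R * (#|B| ^ 2)%:R * (4 * s).
  have c (x : algC) : \sum_(u | P u) x = (#|B| ^ 2)%:R * x.
    by rewrite -card_pairs natr_sum mulr_suml; apply: eq_bigr => u _; rewrite mul1r.
  by rewrite !c mulrA.
apply: (@le_trans _ _ (16 * #|F|%:R * (#|B| ^ 2)%:R + #|F|%:R * (3 * #|B| ^ 2)%:R)).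
  apply: lerD; last by rewrite ler_wpM2l ?ler0n // ler_nat card_diagonal.
  have h4 : (#|B| ^ 2)%:R <= 4 * s.
    rewrite -(ler_pXn2r (n := 2)) ?nnegrE ?mulr_ge0 // exprMn s2 -!natrX -natrM ler_nat.
    by rewrite -expnM.
  rewrite -s2 (_ : 16 * s ^+ 2 * _ = (4 * s) * (#|B| ^ 2)%:R * (4 * s)); last by ring.
  by rewrite ler_wpM2r ?mulr_ge0 // ler_wpM2r.
by rewrite le_eqVlt; apply/orP; left; apply/eqP; rewrite !natrM; ring.
Qed.

(** Hoelder with exponent 4, done as two Cauchy-Schwarz steps; the sum of fourth powers over A is
    then extended to all of F. *)
Lemma norm_bilinear_sum (A : {set F}) : (#|B| ^ 4 <= 16 * #|F|)%N ->
  `|\sum_(a in A) \sum_(b in B) chi (a + b)| ^+ 4 <= (#|A| ^ 3 * (19 * #|F| * #|B| ^ 2))%:R.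
Proof.
move=> hB; pose g a := `|\sum_(b in B) chi (a + b)|.
have g0 a : 0 <= g a by apply: normr_ge0.
have cs (h : F -> algC) : (forall a, 0 <= h a) ->
    (\sum_(a in A) h a) ^+ 2 <= #|A|%:R * \sum_(a in A) h a ^+ 2.
  move=> h0; have := @cauchy_schwarz_sum _ _ (mem A) (fun=> 1) h (fun=> ler01) h0.
  rewrite (eq_bigr h) => [|a _]; last by rewrite mul1r.
  rewrite [X in _ <= X * _](eq_bigr (fun=> 1)) => [|a _]; last by rewrite expr1n.
  by rewrite sumr_const.
have sg0 : 0 <= \sum_(a in A) g a by apply: sumr_ge0.
apply: (@le_trans _ _ ((\sum_(a in A) g a) ^+ 4)).
  by rewrite lerXn2r ?nnegrE // ler_norm_sum.
apply: (@le_trans _ _ ((#|A|%:R * \sum_(a in A) g a ^+ 2) ^+ 2)).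
  have sq0 : 0 <= #|A|%:R * \sum_(a in A) g a ^+ 2.
    by rewrite mulr_ge0 // sumr_ge0 // => a _; rewrite exprn_ge0.
  by rewrite (exprM _ 2 2) lerXn2r ?nnegrE ?exprn_ge0 // cs.
apply: (@le_trans _ _ (#|A|%:R ^+ 2 * (#|A|%:R * \sum_(a in A) (g a ^+ 2) ^+ 2))).
  by rewrite exprMn ler_wpM2l ?exprn_ge0 // cs // => a; rewrite exprn_ge0.
rewrite mulrA -exprSr -natrX natrM ler_wpM2l //.
apply: le_trans (fourth_moment hB).
rewrite [X in _ <= X](bigID (mem A)) /= -[X in X <= _]addr0 lerD //.
  by apply: ler_sum => a _; rewrite -exprM.
by apply: sumr_ge0 => a _; rewrite exprn_ge0.
Qed.

End FourthMoment.

(** * Products and exceptional sets *)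

(** With g a generator of the unit group and z a primitive complex root of unity of the same order,
    the characters send g^i to z^(i j), and orthogonality is a geometric sum. *)
Lemma mulchars_orthogonal (F : finFieldType) :
  exists chi : 'I_(#|F|.-1) -> F -> algC,
    [/\ forall j, mulchar (chi j),
        forall j : 'I_(#|F|.-1), (j : nat) != 0%N -> nontrivial (chi j),
        forall (j : 'I_(#|F|.-1)) x, (j : nat) = 0%N -> x != 0 -> chi j x = 1
      & forall x, x != 0 -> \sum_j chi j x = if x == 1 then (#|F|.-1)%:R else 0].
Proof.
set n := #|F|.-1; have n0 : (0 < n)%N by rewrite /n; have := finNzRing_gt1 F; case: #|F| => [|[]].
have /hasP[g _ gp] : has n.-primitive_root (enum [pred x : F | x != 0]).
  apply: has_prim_root => //; last by rewrite -cardE cardC1.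
    by apply/allP => x; rewrite mem_enum inE => x0; apply/unity_rootP/expf_card_pred.
  exact: enum_uniq.
have [z zp] := C_prim_root_exists n0.
pose log x : nat := if [pick i : 'I_n | g ^+ i == x] is Some i then i else 0%N.
have logK x : x != 0 -> g ^+ log x = x.
  move=> x0; rewrite /log; case: pickP => [i /eqP //|no].
  have /(prim_rootP gp)[i xi] : x ^+ n = 1 by apply: expf_card_pred.
  by have := no i; rewrite xi eqxx.
pose w x := z ^+ log x.
have wM x y : x != 0 -> y != 0 -> w (x * y) = w x * w y.
  move=> x0 y0; rewrite /w -exprD; apply/eqP; rewrite (eq_prim_root_expr zp).
  by rewrite -(eq_prim_root_expr gp) exprD !logK ?mulf_neq0.
have w1 x : x != 0 -> (w x == 1) = (x == 1).
  move=> x0; rewrite /w -(expr0 z) (eq_prim_root_expr zp) -(eq_prim_root_expr gp).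
  by rewrite logK // expr0.
have wn x : w x ^+ n = 1 by rewrite /w exprAC (prim_expr_order zp) expr1n.
exists (fun j x => if x == 0 then 0 else w x ^+ j); split.
- move=> j; split; first by rewrite eqxx.
    by rewrite oner_eq0 (eqP (_ : w 1 == 1)) ?expr1n // w1 ?oner_eq0.
  move=> x y; rewrite mulf_eq0; case: eqVneq => [|x0]; first by rewrite mul0r.
  by case: eqVneq => [|y0] /=; rewrite ?mulr0 // wM // exprMn.
- move=> j j0; have g0 : g != 0.
    apply/eqP => g0; have /eqP := prim_expr_order gp.
    by rewrite g0 expr0n eqn0Ngt n0 eq_sym oner_eq0.
  exists g => //; rewrite (negPf g0).
  have -> : w g = z.
    by apply/eqP; rewrite /w -{2}[z]expr1 (eq_prim_root_expr zp) -(eq_prim_root_expr gp) logK ?expr1.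
  by rewrite -(prim_order_dvd zp) gtnNdvd // lt0n.
- by move=> j x -> /negPf->; rewrite expr0.
move=> x x0; rewrite (negPf x0); case: eqP => [->|/eqP x1].
  have /eqP -> : w 1 == 1 by rewrite w1 ?oner_eq0.
  rewrite (eq_bigr (fun=> 1)) => [|j _]; last by rewrite expr1n.
  by rewrite sumr_const card_ord.
have /eqP := subrX1 (w x) n; rewrite wn subrr eq_sym mulf_eq0 subr_eq0 w1 // (negPf x1) /=.
by move/eqP.
Qed.

(** The absence of solutions makes a sum over all characters vanish. The trivial one contributes [U]
    |X| |E|, where [U] counts only pairs with a + b != 0 because chi 0 = 0; the others are at most
    V^(1/4) times a sum treated by Cauchy-Schwarz and Parseval. *)
Lemma no_solution_bound (F : finFieldType) (A B X E : {set F}) (V : algC) :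
  (forall chi : F -> algC, mulchar chi -> nontrivial chi ->
     `|\sum_(a in A) \sum_(b in B) chi (a + b)| ^+ 4 <= V) ->
  0 <= V -> 0 \notin X -> 0 \notin E ->
  (forall a b x, a \in A -> b \in B -> x \in X -> (a + b) * x \notin E) ->
  (((\sum_(a in A) \sum_(b in B) ((a + b)%R != 0%R)) * #|X| * #|E|) ^ 4)%:R <=
  V * (#|F| ^ 4 * #|X| ^ 2 * #|E| ^ 2)%:R.
Proof.
move=> hV V0 X0 E0 nosol; set U := (\sum_(a in A) _)%N.
have [chi [chiP chiN chi_0 orth]] := mulchars_orthogonal F.
set n := #|F|.-1 in chi chiP chiN chi_0 orth.
have n0 : (0 < n)%N by rewrite /n; have := finNzRing_gt1 F; case: #|F| => [|[]].
pose j0 : 'I_n := Ordinal n0.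
have xn0 (Y : {set F}) x : 0 \notin Y -> x \in Y -> x != 0.
  by move=> Y0 xY; apply: contraNneq Y0 => <-.
pose S j := \sum_(a in A) \sum_(b in B) chi j (a + b).
pose T (Y : {set F}) j := \sum_(x in Y) chi j x.
have key : \sum_j S j * T X j * (T E j)^* = 0.
  rewrite (eq_bigr (fun j => \sum_(a in A) \sum_(b in B) \sum_(x in X) \sum_(e in E)
    chi j ((a + b) * x / e))) => [|j _]; last first.
    case: (chiP j) => _ _ chiM.
    rewrite /S /T -mulrA mulr_suml; apply: eq_bigr => a _; rewrite mulr_suml.
    apply: eq_bigr => b _; rewrite mulrA mulr_sumr mulr_suml; apply: eq_bigr => x _.
    rewrite rmorph_sum mulr_sumr; apply: eq_bigr => e _ /=.
    by rewrite -(mulcharV (chiP j)) -!chiM.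
  rewrite exchange_big big1 // => a aA; rewrite exchange_big big1 // => b bB.
  rewrite exchange_big big1 // => x xX; rewrite exchange_big big1 // => e eE /=.
  have e0 := xn0 _ _ E0 eE; have x0 := xn0 _ _ X0 xX.
  have [ab|ab] := eqVneq (a + b) 0.
    by apply: big1 => j _; rewrite ab !mul0r; case: (chiP j).
  rewrite orth ?mulf_neq0 ?invr_eq0 //; case: eqP => // h.
  have := nosol a b x aA bB xX; rewrite (_ : (a + b) * x = e) ?eE //.
  by rewrite -(mulfVK e0 ((a + b) * x)) h mul1r.
have SXE0 : S j0 * T X j0 * (T E j0)^* = (U * #|X| * #|E|)%:R.
  have TE (Y : {set F}) : 0 \notin Y -> T Y j0 = #|Y|%:R.
    move=> Y0; rewrite /T (eq_bigr (fun=> 1)) ?sumr_const // => x xY.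
    by rewrite chi_0 // (xn0 Y).
  rewrite !TE // rmorph_nat !natrM; congr (_ * _ * _).
  rewrite /S /U natr_sum; apply: eq_bigr => a _; rewrite natr_sum; apply: eq_bigr => b _.
  have [->|ab] := eqVneq (a + b) 0; last by rewrite chi_0.
  by case: (chiP j0).
have parseval (Y : {set F}) : 0 \notin Y -> \sum_j `|T Y j| ^+ 2 = (n * #|Y|)%:R.
  move=> Y0; rewrite (eq_bigr (fun j => \sum_(x in Y) \sum_(y in Y) chi j (x / y))).
    rewrite exchange_big natrM mulrC -sum1_card natr_sum mulr_suml.
    apply: eq_bigr => x xY /=; rewrite exchange_big (bigD1 x) //=.
    rewrite orth ?divff ?oner_eq0 ?(xn0 Y) // eqxx [X in _ + X]big1 ?addr0 ?mul1r // => y.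
    case/andP=> yY yx; have x0 := xn0 _ _ Y0 xY; have y0 := xn0 _ _ Y0 yY.
    rewrite orth ?mulf_neq0 ?invr_eq0 //; case: eqP => // h.
    by case/eqP: yx; rewrite -(mulfVK y0 x) h mul1r.
  move=> j _; rewrite normCK /T rmorph_sum big_distrlr /=; apply: eq_bigr => x _.
  apply: eq_bigr => y _; rewrite -(mulcharV (chiP j)).
  by case: (chiP j) => _ _ ->.
pose M := sqrtC (sqrtC V).
have M0 : 0 <= M by rewrite !sqrtC_ge0.
have M4 : M ^+ 4 = V by rewrite (exprM _ 2 2) !sqrtCK.
have SM j : j != j0 -> `|S j| <= M.
  move=> jj; rewrite -(ler_pXn2r (n := 4)) ?nnegrE // M4; apply: hV => //.
  by apply: chiN.
have bound : (U * #|X| * #|E|)%:R <= M * \sum_j `|T X j| * `|T E j|.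
  move/eqP: key; rewrite (bigD1 j0) //= SXE0 addr_eq0 => /eqP e.
  rewrite -[X in X <= _](normr_nat algC) e normrN; apply: le_trans (ler_norm_sum _ _ _) _.
  rewrite mulr_sumr [X in _ <= X](bigD1 j0) //= -[X in X <= _]add0r lerD ?mulr_ge0 //.
  by apply: ler_sum => j jj; rewrite !normrM norm_conjC -mulrA ler_wpM2r ?mulr_ge0 // SM.
set W := \sum_j _ in bound.
have W2 : W ^+ 2 <= (n * #|X|)%:R * (n * #|E|)%:R.
  by rewrite -!parseval // cauchy_schwarz_sum.
have W0 : 0 <= W by apply: sumr_ge0 => j _; rewrite mulr_ge0.
rewrite natrX; apply: (@le_trans _ _ ((M * W) ^+ 4)).
  by rewrite lerXn2r ?nnegrE ?mulr_ge0.
rewrite exprMn M4 ler_wpM2l // (exprM _ 2 2).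
apply: (@le_trans _ _ (((n * #|X|)%:R * (n * #|E|)%:R) ^+ 2)).
  by rewrite lerXn2r ?nnegrE ?exprn_ge0 ?mulr_ge0.
rewrite -natrM -natrX ler_nat.
rewrite (_ : (n * #|X| * (n * #|E|)) ^ 2 = n ^ 4 * #|X| ^ 2 * #|E| ^ 2)%N; last by ring.
by rewrite !leq_mul2r leq_exp2r // leq_pred !orbT.
Qed.

(* B is generated by a minimal initial segment of the generators; each generator
   at most doubles the cube, hence |B|^4 overshoots Q by a factor at most 16. *)
Lemma hilbert_cube_split (F : finFieldType) (H : {set F}) (Q : nat) :
  is_hilbert_cube H -> (2 <= Q)%N -> (Q <= #|H| ^ 4)%N ->
  exists A B : {set F},
    [/\ forall a b, a \in A -> b \in B -> a + b \in H, (#|H| <= #|A| * #|B|)%N,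
        (Q <= #|B| ^ 4)%N & (#|B| ^ 4 <= 16 * Q)%N].
Proof.
move=> [d [a0 [a HE]]] Q2 QH.
pose low k : {set F} :=
  [set \sum_(i < d) (eps i && (i < k)%N)%:R * a i | eps : {ffun 'I_d -> bool}].
pose high k : {set F} :=
  [set a0 + \sum_(i < d) (eps i && (k <= i)%N)%:R * a i | eps : {ffun 'I_d -> bool}].
have low_high k x y : x \in high k -> y \in low k -> x + y \in H.
  move=> /imsetP[e1 _ ->] /imsetP[e2 _ ->]; rewrite HE -addrA -big_split /=.
  apply/imsetP; exists [ffun i : 'I_d => if (i < k)%N then e2 i else e1 i] => //.
  congr (_ + _); apply: eq_bigr => i _; rewrite ffunE -mulrDl; congr (_ * _).
  by case: ltnP => _; rewrite ?andbF ?andbT ?add0r ?addr0.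
have cardH k : (#|H| <= #|high k| * #|low k|)%N.
  rewrite -cardsX; apply: (@leq_trans #|[set x.1 + x.2 | x in setX (high k) (low k)]|).
    apply/subset_leq_card/subsetP => x; rewrite HE => /imsetP[eps _ ->].
    apply/imsetP; exists (a0 + \sum_(i < d) (eps i && (k <= i)%N)%:R * a i,
        \sum_(i < d) (eps i && (i < k)%N)%:R * a i).
      by rewrite in_setX; apply/andP; split; apply: imset_f.
    rewrite /= -addrA -big_split; congr (_ + _); apply: eq_bigr => i _ /=.
    rewrite -mulrDl; congr (_ * _).
    by case: ltnP => _; rewrite ?andbF ?andbT ?add0r ?addr0.
  exact: leq_imset_card.
have low0 : #|low 0%N| = 1%N.
  apply/eqP/cards1P; exists 0; apply/setP => x; rewrite inE; apply/imsetP/eqP.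
    by move=> [eps _ ->]; apply: big1 => i _; rewrite ltn0 andbF mul0r.
  move=> ->; exists [ffun=> false] => //; symmetry.
  by apply: big1 => i _; rewrite ltn0 andbF mul0r.
have lowS k : (#|low k.+1| <= 2 * #|low k|)%N.
  have [dk|kd] := leqP d k.
    have -> : low k.+1 = low k.
      apply: eq_imset => eps; apply: eq_bigr => i _.
      by rewrite !(leq_trans (ltn_ord i)) // ltnW.
    by rewrite leq_pmull.
  pose w := a (Ordinal kd).
  apply: (@leq_trans #|low k :|: [set x + w | x in low k]|).
    apply/subset_leq_card/subsetP => x /imsetP[eps _ ->]; rewrite inE.
    rewrite (bigD1 (Ordinal kd)) //= ltnS leqnn andbT.
    have e : \sum_(i < d | i != Ordinal kd) (eps i && (i < k.+1)%N)%:R * a i =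
        \sum_(i < d) (eps i && (i < k)%N)%:R * a i.
      rewrite [RHS](bigD1 (Ordinal kd)) //= ltnn andbF mul0r add0r.
      apply: eq_bigr => i ik; congr ((_ && _)%:R * _).
      by rewrite ltnS leq_eqVlt -[(i : nat) == k]/(i == Ordinal kd) (negPf ik).
    rewrite e; case: (eps _); last by rewrite mul0r add0r imset_f.
    by rewrite mul1r addrC; apply/orP; right; apply: imset_f; apply: imset_f.
  apply: leq_trans (leq_card_setU _ _) _; rewrite mul2n -addnn leq_add2l.
  exact: leq_imset_card.
have lowd : #|low d| = #|H|.
  rewrite -(card_imset (low d) (@addrI F a0)) HE; congr #|pred_of_set _|.
  apply/setP => x; apply/imsetP/imsetP.
    move=> [y /imsetP[eps _ ->] ->]; exists eps => //.
    by congr (_ + _); apply: eq_bigr => i _; rewrite ltn_ord andbT.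
  move=> [eps _ ->]; exists (\sum_(i < d) (eps i && (i < d)%N)%:R * a i).
    exact: imset_f.
  by congr (_ + _); apply: eq_bigr => i _; rewrite ltn_ord andbT.
have exk : exists k, (Q <= #|low k| ^ 4)%N by exists d; rewrite lowd.
have [k Qk mink] := ex_minnP exk.
exists (high k), (low k); split => //; first exact: low_high.
(* The case k = 0 is excluded by Q >= 2, since [low 0] is a single point; hence minimality can be
   applied to the predecessor. *)
case: k Qk mink => [|k] Qk mink; first by move: Qk; rewrite low0; lia.
have lt : (#|low k| ^ 4 < Q)%N.
  by rewrite ltnNge; apply/negP => /mink; rewrite ltnn.
apply: (@leq_trans ((2 * #|low k|) ^ 4)%N); first by rewrite leq_exp2r.
by rewrite expnMn leq_mul2l ltnW ?orbT.
Qed.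

(* The constant is kept symbolic, as numerals of this size are unary. *)
Lemma exceptional_set_bound (k : nat) (F : finFieldType) (H X E : {set F}) :
  (304 <= k)%N -> prime #|F| -> is_hilbert_cube H -> 0 \notin X -> (#|H| <= #|X|.+1)%N ->
  (forall h x, h \in H -> x \in X -> h * x \notin E) ->
  (#|E| ^ 8 * #|H| ^ 12 <= 2 ^ 8 * (2 ^ 8 * (k ^ 4 * #|F| ^ 19)))%N.
Proof.
move=> hk F_pr cubeH X0 HX nosol; set q := #|F|; set h := #|H|.
have q2 : (2 <= q)%N by apply: prime_gt1.
have hq : (h <= q)%N by apply: max_card.
have k0 : (0 < k)%N by apply: leq_trans hk.
have kz z : (z <= k ^ 4 * z)%N by rewrite leq_pmull // expn_gt0 k0.
have ez z : (z <= 2 ^ 8 * z)%N by rewrite leq_pmull.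
(* Allowing for 0 in E at most doubles a nonempty E, which costs one factor 2^8. *)
suff key : (#|E :\ 0%R| ^ 8 * h ^ 12 <= 2 ^ 8 * (k ^ 4 * q ^ 19))%N.
  have e1 : (#|E| <= #|E :\ 0%R|.+1)%N by rewrite (cardsD1 0%R E); case: (_ \in _).
  have [E0|Epos] := posnP #|E :\ 0%R|.
    rewrite E0 in e1; apply: (@leq_trans (1 ^ 8 * q ^ 12)%N).
      by apply: leq_mul; rewrite leq_exp2r.
    rewrite exp1n mul1n; apply: leq_trans (ez _); apply: leq_trans (ez _).
    by apply: leq_trans (kz _); rewrite leq_exp2l.
  apply: (@leq_trans ((2 * #|E :\ 0%R|) ^ 8 * h ^ 12)%N).
    by rewrite leq_mul2r leq_exp2r //; apply/orP; right; lia.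
  by rewrite expnMn -mulnA leq_mul2l key orbT.
(* For a cube with fewer than q^(1/4) elements, |E| <= q suffices. *)
have [hs|qh] := ltnP (h ^ 4)%N q.
  apply: (@leq_trans (q ^ 8 * q ^ 3)%N).
    apply: leq_mul; first by rewrite leq_exp2r // max_card.
    by rewrite (expnM h 4 3) leq_exp2r // ltnW.
  by rewrite -expnD; apply: leq_trans (ez _); apply: leq_trans (kz _); rewrite leq_exp2l.
have [A [B [AB HAB QB BQ]]] := hilbert_cube_split cubeH q2 qh.
set E' := E :\ 0.
have E'0 : 0 \notin E' by rewrite !inE eqxx.
have := @no_solution_bound F A B X E' (#|A| ^ 3 * (19 * q * #|B| ^ 2))%:R.
set U := (\sum_(a in A) _)%N => nsb.
have {nsb} : ((U * #|X| * #|E'|) ^ 4 <= #|A| ^ 3 * (19 * q * #|B| ^ 2) * (q ^ 4 * #|X| ^ 2 * #|E'| ^ 2))%N.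
  rewrite -(ler_nat algC) natrM; apply: nsb => //.
  - by move=> chi chiP chiN; apply: norm_bilinear_sum.
  - by move=> a b x aA bB xX; rewrite inE negb_and nosol ?orbT // AB.
have B2 : (2 <= #|B|)%N.
  rewrite ltnNge; apply/negP => B1; have : (#|B| ^ 4 <= 1 ^ 4)%N by rewrite leq_exp2r.
  by rewrite exp1n; lia.
(* For each a only b = -a gives a zero sum, and |B| >= 2, so at least half of the pairs survive. *)
have U2 : (#|A| * #|B| <= 2 * U)%N.
  rewrite /U big_distrr /= -sum1_card big_distrl /=; apply: leq_sum => a aA; rewrite mul1n.
  have : (#|B| <= 1 + \sum_(b in B) ((a + b)%R != 0%R))%N.
    rewrite -[X in (X <= _)%N]sum1_card.
    apply: (@leq_trans (\sum_(b in B) ((b == - a)%R + ((a + b)%R != 0%R))))%N.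
      by apply: leq_sum => b _; rewrite [a + b]addrC -addr_eq0; case: eqP.
    rewrite big_split /= leq_add2r.
    rewrite big_mkcond (bigD1 (- a)) //= big1 ?addn0 => [|b /negPf->]; last by case: ifP.
    by rewrite eqxx; case: ifP.
  by move: B2; move: (\sum_(b in B) ((a + b)%R != 0%R))%N #|B| => S c; clear; lia.
have h2 : (2 <= h)%N.
  rewrite ltnNge; apply/negP => h1; have : (h ^ 4 <= 1 ^ 4)%N by rewrite leq_exp2r.
  by rewrite exp1n; lia.
have X2 : (h <= 2 * #|X|)%N by rewrite /h; lia.
move: HAB QB BQ B2 U2 X2; rewrite -/h.
move: #|A| #|B| #|X| #|E'| U => s t x e u.
move=> hst qt _ t2 stu hx hU.
have [->|e0] := posnP e; first by rewrite exp0n // mul0n.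
have s0 : (0 < s)%N by rewrite lt0n; apply/eqP => s0; move: hst; rewrite s0 mul0n; lia.
have x0 : (0 < x)%N by lia.
have t0 : (0 < t)%N by apply: ltnW.
(* The inequality [hU] with u replaced by s t / 2 and the common factor cancelled; 304 is 16 times
   19. *)
have h1 : (s * t ^ 2 * x ^ 2 * e ^ 2 <= k * q ^ 5)%N.
  rewrite -(@leq_pmul2l (s ^ 3 * t ^ 2 * x ^ 2 * e ^ 2)); last first.
    by rewrite !muln_gt0 ?expn_gt0 ?s0 ?x0 ?e0 ?t0.
  apply: (@leq_trans ((2 * u * x * e) ^ 4)%N).
    rewrite (_ : s ^ 3 * t ^ 2 * x ^ 2 * e ^ 2 * (s * t ^ 2 * x ^ 2 * e ^ 2) = (s * t * x * e) ^ 4)%N.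
      by rewrite leq_exp2r // !leq_mul2r stu !orbT.
    by ring.
  rewrite (_ : (2 * u * x * e) ^ 4 = 16 * (u * x * e) ^ 4)%N; last by ring.
  apply: leq_trans (leq_mul (leqnn 16) hU) _.
  apply: (@leq_trans (s ^ 3 * t ^ 2 * x ^ 2 * e ^ 2 * (304 * q ^ 5))%N).
    by apply: eq_leq; ring.
  by rewrite leq_mul2l leq_mul2r hk !orbT.
have h2' : (h * t * x ^ 2 * e ^ 2 <= k * q ^ 5)%N.
  apply: leq_trans h1; rewrite !leq_mul2r; apply/orP; right; apply/orP; right.
  by rewrite -[(t ^ 2)%N]/(t * t)%N mulnA leq_mul2r hst orbT.
(* In the fourth power of [h2'], the factor t^4 >= q gains one power of q. *)
have h3 : (q * (h ^ 4 * x ^ 8 * e ^ 8) <= q * (k ^ 4 * q ^ 19))%N.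
  apply: (@leq_trans ((h * t * x ^ 2 * e ^ 2) ^ 4)%N).
    rewrite (_ : (h * t * x ^ 2 * e ^ 2) ^ 4 = t ^ 4 * (h ^ 4 * x ^ 8 * e ^ 8))%N.
      by rewrite leq_mul2r qt orbT.
    by ring.
  apply: (@leq_trans ((k * q ^ 5) ^ 4)%N); first by rewrite leq_exp2r.
  by rewrite expnMn -expnM mulnCA -expnS.
rewrite leq_pmul2l in h3; last exact: ltnW.
apply: (@leq_trans (e ^ 8 * (h ^ 4 * (2 * x) ^ 8))%N).
  by rewrite (expnD h 4 8) !leq_mul2l leq_exp2r // hx !orbT.
rewrite (_ : e ^ 8 * (h ^ 4 * (2 * x) ^ 8) = 2 ^ 8 * (h ^ 4 * x ^ 8 * e ^ 8))%N; last by ring.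
by rewrite leq_mul2l h3 orbT.
Qed.

Theorem corollary1p2 (R : realType) :
  exists c : R, 0 < c /\
    forall (p : nat), prime p ->
    forall (H : {set 'F_p}), is_hilbert_cube H ->
    let E := ~: prod_set H H in
    let F := ~: prod_set H (inv_set H) in
    #|E|%:R <= c * p%:R `^ (19 / 8) * #|H|%:R `^ (- (3 / 2)) /\
    #|F|%:R <= c * p%:R `^ (19 / 8) * #|H|%:R `^ (- (3 / 2)).
Proof.
have [k hk] : exists k, (304 <= k)%N by exists 304%N.
have k0 : (0 < k)%N by apply: leq_trans hk.
have [C [C0 CE]] : exists C, (0 < C)%N /\ C = (2 ^ 8 * (2 ^ 8 * k ^ 4))%N.
  by eexists; split; last reflexivity; rewrite !muln_gt0 ?expn_gt0 ?k0.
exists C%:R; split; first by rewrite ltr0n.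
move=> p p_pr H cubeH E F.
have cF : #|'F_p| = p by rewrite card_Fp.
have F_pr : prime #|'F_p| by rewrite cF.
have H0 : (0 < #|H|)%N.
  have [d [a0 [a ->]]] := cubeH; apply/card_gt0P.
  by exists (a0 + \sum_(i < d) ([ffun=> false] i)%:R * a i); apply: imset_f.
(* Eighth powers turn the exponents 19/8 and -3/2 into 19 and -12; the constant is absorbed by C <=
   C^8. *)
have bound (m : nat) : (m ^ 8 * #|H| ^ 12 <= 2 ^ 8 * (2 ^ 8 * (k ^ 4 * #|'F_p| ^ 19)))%N ->
    m%:R <= C%:R * p%:R `^ (19 / 8) * #|H|%:R `^ (- (3 / 2)) :> R.
  rewrite cF => hm; have pw (x : R) (r : R) n : 0 <= x -> (x `^ r) ^+ n = x `^ (r * n%:R).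
    by move=> x0; rewrite -powR_mulrn ?powR_ge0 // powRrM.
  rewrite -(ler_pXn2r (n := 8)) ?nnegrE ?mulr_ge0 ?powR_ge0 ?ler0n //.
  rewrite !exprMn !pw ?ler0n //.
  have -> : 19 / 8 * 8%:R = 19%:R :> R by field.
  have -> : - (3 / 2) * 8%:R = - 12%:R :> R by field.
  rewrite powRN !powR_mulrn ?ler0n // ler_pdivlMr ?exprn_gt0 ?ltr0n //.
  rewrite -!natrX -!natrM ler_nat; apply: leq_trans hm _; rewrite 2!mulnA -[(2 ^ 8 * 2 ^ 8 * _)%N]mulnA -CE.
  by rewrite leq_mul2r; apply/orP; right; rewrite -{1}[C]expn1 leq_pexp2l.
have card_nz : (#|H| <= #|H :\ 0%R|.+1)%N by rewrite (cardsD1 0%R H); case: (_ \in _).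
split; apply: bound.
  (* Only the nonzero elements of H serve as second factors here, and only their inverses in the
     quotient case; at most one element is lost. *)
  apply: (exceptional_set_bound (k := k) (X := H :\ 0)) => //; first by rewrite !inE eqxx.
  move=> h x hH; rewrite inE => /andP[_ xH]; rewrite /E inE negbK.
  by apply/imset2P; exists h x.
have invE : inv_set H = [set x^-1 | x in H :\ 0].
  apply/setP => y; apply/imsetP/imsetP => -[x]; rewrite !inE => /andP[h1 h2] ->;
    by exists x; rewrite // !inE h1 h2.
apply: (exceptional_set_bound (k := k) (X := inv_set H)) => //.
- by apply/imsetP => -[x]; rewrite inE => /andP[_ x0] /esym/eqP; rewrite invr_eq0 (negPf x0).
- by rewrite invE card_imset //; apply: invr_inj.
- move=> h x hH xH; rewrite /F inE negbK.
  by apply/imset2P; exists h x.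
Qed.
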